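(* Let $n\ge 3$. For any multi-index $\beta$ with $|\beta|=k\ge 2$ and any $f\in\mathcal{C}_c^\infty(\mathbb{R}^n)$, the principal value $\mathrm{p.v.}\int_{\mathbb{R}^n}D^\beta\Gamma(x-y)f(y)\,dy$ exists for all $x\in\mathbb{R}^n$. Moreover, if $R>0$ and $\mathrm{supp} f\subset\mathbf{B}_R$, then $$\mathrm{p.v.}\int_{\mathbb{R}^n}D^\beta\Gamma(x-y)f(y)\,dy=\int_{\mathbf{B}_R}D^\beta\Gamma(x-y)\big(f(y)-T^x_{k-2}(f)(y)\big)\,dy,$$ and the integral on the right-hand side is independent of $R$.
   Context: $\mathbf{B}_R=\{x\in\mathbb{R}^n:|x|<R\}$ and $\mathbf{B}_\epsilon(x)$ is the ball centered at $x$ of radius $\epsilon$. $\Gamma(x)=c_n|x|^{2-n}$, $c_n=\frac{1}{n(2-n)\omega_n}$ with $\omega_n$ the volume of the unit ball of $\mathbb{R}^n$, is the fundamental solution of the Laplacian, and $D^\beta\Gamma(x-y)$ is $D^\beta\Gamma$ evaluated at $x-y$. $\mathcal{C}_c^\infty(\mathbb{R}^n)$ is the set of smooth compactly supported functions. By definition $\mathrm{p.v.}\int_{\mathbb{R}^n}D^\beta\Gamma(x-y)f(y)\,dy=\lim_{\epsilon\to0}\int_{\mathbb{R}^n\setminus\mathbf{B}_\epsilon(x)}D^\beta\Gamma(x-y)f(y)\,dy$. $T^x_j(f)(y)=\sum_{|\mu|\le j}\frac{D^\mu f(x)}{\mu!}(y-x)^\mu$ is the $j$-th order Taylor polynomial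 of $f$ at $x$. *)

(* Defs.v *)
From HB Require Import structures.
From mathcomp Require Import all_boot all_order all_algebra.
From mathcomp Require Import all_classical all_reals all_analysis.

Set Implicit Arguments.
Unset Strict Implicit.
Unset Printing Implicit Defensive.

Import Order.TTheory GRing.Theory Num.Theory.
Import numFieldNormedType.Exports.

Local Open Scope classical_set_scope.
Local Open Scope ring_scope.

Definition rV_display : measure_display -> measure_display.
Proof. exact. Qed.

(* The product sigma-algebra, as the library does for n.-tuple T; it is the
   Borel one for 'rV[R]_n. *)
Section measurable_rV.
Context {d : measure_display} {T : measurableType d}.
Variable n : nat.

Let coord (i : 'I_n) (v : 'rV[T]_n) : T := v ord0 i.

Let rV_set0 : g_sigma_preimage coord set0.
Proof. exact: sigma_algebra0. Qed.

Let rV_setC A : g_sigma_preimage coord A -> g_sigma_preimage coord (~` A).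
Proof. exact: sigma_algebraC. Qed.

Let rV_bigcup (F : _^nat) : (forall i, g_sigma_preimage coord (F i)) ->
  g_sigma_preimage coord (\bigcup_i (F i)).
Proof. exact: sigma_algebra_bigcup. Qed.

HB.instance Definition _ := @isMeasurable.Build (rV_display d)
  'rV[T]_n (g_sigma_preimage coord) rV_set0 rV_setC rV_bigcup.

End measurable_rV.

Lemma measurable_fun_rV d1 d2 (T1 : measurableType d1) (T2 : measurableType d2)
    (n : nat) (f : T1 -> 'rV[T2]_n) :
  (forall i, measurable_fun setT (fun x => f x ord0 i)) ->
  measurable_fun setT f.
Proof.
move=> mf _ A mA.
suff : preimage_set_system setT f
    (g_sigma_preimage (fun (i : 'I_n) (v : 'rV[T2]_n) => v ord0 i))
    `<=` measurable.
  by apply; exists A.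
rewrite -g_sigma_preimageE; apply: smallest_sub.
  exact: sigma_algebra_measurable.
rewrite /preimage_set_system => _ [B + <-].
rewrite -bigcup_seq/= => -[i _ [C mC <-]].
rewrite !setTI -[X in measurable X]setTI; exact: mf.
Qed.

Section lebesgue_measure_rV.
Context {R : realType}.

Definition cons_rV n (p : 'rV[R]_n * measurableTypeR R) : 'rV[R]_n.+1 :=
  row_mx (const_mx p.2 : 'rV[R]_1) p.1.

Lemma measurable_coord_rV n (i : 'I_n) :
  measurable_fun setT (fun v : 'rV[R]_n => v ord0 i).
Proof.
move=> _ Y mY; rewrite setTI; apply: sub_sigma_algebra => /=.
rewrite -bigcup_seq/=; exists i => /=; first by rewrite mem_index_enum.
by exists Y => //; rewrite setTI.
Qed.

Lemma measurable_cons_rV n : measurable_fun setT (@cons_rV n).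
Proof.
apply: measurable_fun_rV => i; case: (split_ordP (i : 'I_(1 + n))) => j ->.
  rewrite [X in measurable_fun _ X](_ : _ = snd); first exact: measurable_snd.
  by apply/funext => p; apply: (etrans (row_mxEl _ _ _ _)); rewrite mxE.
rewrite [X in measurable_fun _ X](_ : _ = (fun v : 'rV[R]_n => v ord0 j) \o fst).
  exact: (measurableT_comp (measurable_coord_rV j) measurable_fst).
by apply/funext => p; exact: row_mxEr.
Qed.

Lemma measurable_uncons_rV n :
  measurable_fun setT (fun v : 'rV[R]_n.+1 =>
    (rsubmx (v : 'rV[R]_(1 + n)), v ord0 ord0 : measurableTypeR R)).
Proof.
apply/measurable_fun_pair; last exact: measurable_coord_rV.
apply: measurable_fun_rV => i.
rewrite [X in measurable_fun _ X](_ : _ = fun v : 'rV[R]_n.+1 =>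
    v ord0 (rshift 1 i)); first exact: measurable_coord_rV.
by apply/funext => v; rewrite mxE.
Qed.

Section product_rV.
Variables (n : nat) (mu : {sigma_finite_measure set 'rV[R]_n -> \bar R}).

Definition product_rV : set 'rV[R]_n.+1 -> \bar R :=
  pushforward (mu \x @lebesgue_measure R)%E (@cons_rV n).

Let product_rV0 : product_rV set0 = 0%E.
Proof. by rewrite /product_rV /pushforward preimage_set0 measure0. Qed.

Let product_rV_ge0 A : (0 <= product_rV A)%E.
Proof. by rewrite /product_rV /pushforward measure_ge0. Qed.

Let product_rV_sigma_additive : semi_sigma_additive product_rV.
Proof.
exact: (@measure_semi_sigma_additive _ _ _
  (measure_function_pushforward__canonical__measure_function_Measure
    (mu \x @lebesgue_measure R)%E (@measurable_cons_rV n))).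
Qed.

HB.instance Definition _ := isMeasure.Build _ _ _ product_rV
  product_rV0 product_rV_ge0 product_rV_sigma_additive.

Let product_rV_sigma_finite : sigma_finite setT product_rV.
Proof.
have /sigma_finiteP[F [FT ndF mF]] := sigma_finiteT mu.
have /sigma_finiteP[G [GT ndG mG]] := sigma_finiteT (@lebesgue_measure R).
pose un (v : 'rV[R]_n.+1) :=
  (rsubmx (v : 'rV[R]_(1 + n)), v ord0 ord0 : measurableTypeR R).
have consK : cancel (@cons_rV n) un.
  move=> [v t]; rewrite /un /cons_rV row_mxKr; congr (_, _).
  have -> : ord0 = lshift n ord0 :> 'I_(1 + n) by apply/val_inj.
  by apply: (etrans (row_mxEl _ _ _ _)); rewrite mxE.
exists (fun k => un @^-1` (F k `*` G k)).
  rewrite -preimage_bigcup; apply/seteqP; split => // v _; rewrite /preimage/=.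
  have [i _ Fi] : (\bigcup_k F k) (un v).1 by rewrite -FT.
  have [j _ Gj] : (\bigcup_k G k) (un v).2 by rewrite -GT.
  exists (maxn i j) => //; split.
  - by move: Fi; exact/subsetPset/ndF/leq_maxl.
  - by move: Gj; exact/subsetPset/ndG/leq_maxr.
move=> k; have [mFk Fk] := mF k; have [mGk Gk] := mG k; split.
  rewrite -[X in measurable X]setTI; apply: measurable_uncons_rV => //.
  exact: measurableX.
rewrite /product_rV /pushforward -comp_preimage.
rewrite (_ : un \o @cons_rV n = id); last by apply/funext => p; exact: consK.
by rewrite preimage_id product_measure1E// lte_mul_pinfty// ge0_fin_numE.
Qed.

HB.instance Definition _ := Measure_isSigmaFinite.Build _ _ _ product_rV
  product_rV_sigma_finite.

End product_rV.

(* Lebesgue measure on R^n, as the n-fold product of lebesgue_measure. *)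
Fixpoint lebesgue_rV n : {sigma_finite_measure set 'rV[R]_n -> \bar R} :=
  match n with
  | 0 => dirac (0 : 'rV[R]_0)
  | m.+1 => product_rV (lebesgue_rV m)
  end.

End lebesgue_measure_rV.

Section calculus_rV.
Context {R : realType} {n : nat}.
Implicit Types (f : 'rV[R]_n -> R) (x y : 'rV[R]_n) (b : 'I_n -> nat).

(* The Euclidean norm; `|x| is the sup norm on 'rV[R]_n. *)
Definition enorm x : R := Num.sqrt (\sum_(i < n) x ord0 i ^+ 2).

Definition eball x (r : R) : set 'rV[R]_n := [set y | enorm (y - x) < r].

Definition partial (i : 'I_n) f : 'rV[R]_n -> R :=
  fun x => 'D_(delta_mx ord0 i) f x.

Definition smooth f := forall s : seq 'I_n,
  continuous (foldr partial f s) /\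
  forall i x, derivable (foldr partial f s) x (delta_mx ord0 i).

Definition supp f : set 'rV[R]_n := closure [set x | f x != 0].

Definition Cc_infty f := smooth f /\ compact (supp f).

Definition mdeg b : nat := (\sum_(i < n) b i)%N.

Definition mfact b : nat := (\prod_(i < n) (b i)`!)%N.

Definition mpow x b : R := \prod_(i < n) x ord0 i ^+ b i.

Definition mpartial b f : 'rV[R]_n -> R :=
  foldr (fun i => iter (b i) (partial i)) f (enum 'I_n).

(* A multi-index of degree at most j has all its entries at most j. *)
Definition taylor (j : nat) x f y : R :=
  \sum_(m : {ffun 'I_n -> 'I_j.+1} | (mdeg (val \o m) <= j)%N)
    mpartial (val \o m) f x / (mfact (val \o m))%:R * mpow (y - x) (val \o m).

End calculus_rV.

Section fundamental_solution.
Context {R : realType} {n : nat}.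
Implicit Types (f : 'rV[R]_n -> R) (x : 'rV[R]_n) (b : 'I_n -> nat).

Definition unit_ball_volume : R :=
  fine (lebesgue_rV n (eball (0 : 'rV[R]_n) 1)).

(* c_n |x|^(2 - n); the exponent is a (negative) integer, and the value at 0,
   where 0^-1 = 0, is irrelevant. *)
Definition Gamma x : R :=
  (n%:R * (2 - n%:R) * unit_ball_volume)^-1 * enorm x ^ (2 - n%:Z).

Definition truncated b f x (e : R) : R :=
  \int[lebesgue_rV n]_(y in ~` eball x e) (mpartial b Gamma (x - y) * f y).

(* pv is only meaningful together with pv_exists. *)
Definition pv b f x : R := lim (truncated b f x e @[e --> 0^'+]).

Definition pv_exists b f x :=
  (forall e : R, 0 < e -> (lebesgue_rV n).-integrable (~` eball x e)
    (fun y => (mpartial b Gamma (x - y) * f y)%:E)) /\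
  cvg (truncated b f x e @[e --> 0^'+]).

End fundamental_solution.

(* Main.v *)
Require Import Defs.
From HB Require Import structures.
From mathcomp Require Import all_boot all_order all_algebra.
From mathcomp Require Import all_classical all_reals all_analysis.
From mathcomp Require Import measurable_realfun.
From mathcomp Require Import zify ring lra.

(** Let [k] be the order of the derivative [beta]. Off the origin the kernel
    [D^beta Gamma z] has the form [Q z / |z|^(n + 2k - 2)] with [Q] a harmonic
    homogeneous polynomial of degree [k] ([kelvin_mpartial_Gamma]). Its
    homogeneity is [2 - n - k], so it is not integrable at 0, and the principal
    value exists because of a cancellation: if [|x| < r] and [e] is small, the
    kernel [D^beta Gamma (x - y)] is orthogonal, on the pierced ball
    [{ |y| < r, |x - y| >= e }], to every polynomial in [y] of degree at most
    [k - 2] ([annihilation], [taylor_annihilated]).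

    Hence, when [f] vanishes off the ball of radius [r], its truncated integral
    is the integral over the pierced ball of the kernel against [f - T], where
    [T] is the Taylor polynomial of degree [k - 2] of [f] at [x]
    ([truncated_remainder]). Since [f - T] is of order [|x - y|^(k - 1)]
    ([taylor_bound]), the integrand is of order [|x - y|^(1 - n)]: it is
    integrable over the whole ball, and removing the ball of radius [e] about
    [x] costs [O(e)] ([integral_weak_singularity], [truncated_error]). So the
    truncated integrals converge to the integral over the ball of radius [r],
    which therefore does not depend on [r]. If [|x| >= r], then [f] vanishes
    near [x], because its support is a closed subset of the open ball; so
    [T = 0] and the cancellation is trivial.

    To prove the cancellation, put [z = x - y] and let [p] be homogeneous of
    degree [m <= k - 2]. The function [K z = Q z * p z / |z|^(n + 2k - 2)] is
    homogeneous of degree [- (n + j)] with [j = k - 2 - m]; it is to be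
    integrated over [O = { |z| >= e, |x - z| < r }]. Tonelli's theorem and the
    dilations [y = t z] give, for a radial weight [w],

      [int w(|z|) K(z) q(z) dz = c int_O K],
      [q(z) = int_0^oo t^(-j - 1) 1_O (t z) dt],

    with [c > 0] depending on [w] only ([polar_tonelli], [average]). The ray
    through [z] enters [O] at the time [e / |z|] and leaves it at a time
    [tau(z)], the positive root of [|x - t z| = r], so that [q] is explicit.
    Although [q] is not a polynomial, [q(z) + (-1)^j q(-z)] is one,
    homogeneous of degree [j]: [1 / tau(z)] and [- 1 / tau(-z)] are the two
    roots of a quadratic equation with coefficients polynomial in [z], and
    their power sums are polynomials ([symmetrized_ray]). The weight is even,
    hence [q] may be replaced by half of this polynomial, and [int_O K] is a
    multiple of the integral of [Q] against a polynomial of degree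
    [m + j = k - 2] with a radial weight. Such integrals vanish, since a
    harmonic homogeneous polynomial is orthogonal to the polynomials of lower
    degree; this comes from the divergence theorem for compactly supported
    fields ([harmonic_orthogonal]). *)

Set Implicit Arguments.
Unset Strict Implicit.
Unset Printing Implicit Defensive.

Import Order.TTheory GRing.Theory Num.Theory.
Import numFieldNormedType.Exports.

Local Open Scope classical_set_scope.
Local Open Scope ring_scope.

(** * Homogeneous polynomials and the Euclidean norm *)

Section homogeneous.
Context {R : realType} {n : nat}.
Implicit Types (z v : 'rV[R]_n) (p q : 'rV[R]_n -> R) (d : nat) (i j : 'I_n).

Local Notation e_ i := (delta_mx ord0 i : 'rV[R]_n).

(** Turns directional derivatives into derivatives of functions of one
    variable, to which the chain rule and the mean value theorem apply. *)
Lemma is_derive_line (f : 'rV[R]_n -> R) z v (d : R) :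
  is_derive z v f d <-> is_derive (0 : R) 1 (fun t : R => f (t *: v + z)) d.
Proof.
have E : (fun h : R => h^-1 *: ((f \o shift z) (h *: v) - f z)) =
  (fun h : R => h^-1 *: (((fun t : R => f (t *: v + z)) \o shift 0) (h *: 1) -
    (fun t : R => f (t *: v + z)) 0)).
  by apply/funext => h /=; rewrite addr0 scale0r add0r [_%:A]mulr1.
split=> -[fv fd]; split.
- exact: (derivable1P f z v).1.
- by rewrite -fd /derive E.
- exact: (derivable1P f z v).2.
- by rewrite -fd /derive E.
Qed.

Lemma is_derive_line_at (f : 'rV[R]_n -> R) z v (t d : R) :
  is_derive (t *: v + z) v f d -> is_derive t 1 (fun t : R => f (t *: v + z)) d.
Proof.
move=> [fv fd]; have E :
  (fun h : R => h^-1 *: ((f \o shift (t *: v + z)) (h *: v) - f (t *: v + z))) =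
  (fun h : R => h^-1 *: (((fun t : R => f (t *: v + z)) \o shift t) (h *: 1) -
    (fun t : R => f (t *: v + z)) t)).
  by apply/funext => h /=; rewrite [_%:A]mulr1 scalerDl addrA.
by split; [move: fv; rewrite /derivable E | rewrite -fd /derive E].
Qed.

Lemma is_derive_coord z i j :
  is_derive z (e_ j) (fun z => z ord0 i) ((i == j)%:R : R).
Proof.
apply/is_derive_line.
have -> : (fun t : R => (t *: e_ j + z) ord0 i) =
   (fun t : R => (i == j)%:R * t + z ord0 i).
  by apply/funext => t; rewrite !mxE eqxx /= mulrC.
have h1 : is_derive (0 : R) (1 : R) (fun t : R => (i == j)%:R * t) ((i == j)%:R : R).
  rewrite -[X in is_derive _ _ _ X]mulr1.
  exact: (@is_deriveZ _ _ _ id).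
rewrite -[X in is_derive _ _ _ X]addr0.
exact: (@is_deriveD _ _ _ _ (fun=> z ord0 i) _ _ _ _ h1 (is_derive_cst _ _ _)).
Qed.

Lemma partialE (f : 'rV[R]_n -> R) i z (d : R) :
  is_derive z (e_ i) f d -> partial i f z = d.
Proof. by move=> h; rewrite /partial derive_val. Qed.

(** Homogeneous polynomial functions, generated by the operations that build
    them, so that their properties are proved by induction. The function 0 has
    every degree. *)
Inductive homog : nat -> ('rV[R]_n -> R) -> Prop :=
| homog_cst c : homog 0 (fun=> c)
| homog_0 d : homog d (fun=> 0)
| homog_X d i p : homog d p -> homog d.+1 (fun z => z ord0 i * p z)
| homog_D d p q : homog d p -> homog d q -> homog d (fun z => p z + q z).

Lemma homogZ d p (c : R) : homog d p -> homog d (fun z => c * p z).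
Proof.
elim=> {d p} [a|d|d i p _ ih|d p q _ ihp _ ihq].
- exact: homog_cst.
- by under eq_fun do rewrite mulr0; exact: homog_0.
- by under eq_fun do rewrite mulrCA; exact: homog_X.
- by under eq_fun do rewrite mulrDr; exact: homog_D.
Qed.

Lemma homogM d e p q : homog d p -> homog e q -> homog (d + e) (fun z => p z * q z).
Proof.
move=> hp hq; elim: hp => {d p} [a|d|d i p _ ih|d p p' _ ihp _ ihp'].
- exact: homogZ.
- by under eq_fun do rewrite mul0r; exact: homog_0.
- by under eq_fun do rewrite -mulrA; exact: homog_X.
- by under eq_fun do rewrite mulrDl; exact: homog_D.
Qed.

Lemma homog_coord i : homog 1 (fun z => z ord0 i).
Proof.
have -> : (fun z => z ord0 i) = (fun z => z ord0 i * (fun=> 1) z) :> ('rV[R]_n -> R).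
  by apply/funext => z; rewrite mulr1.
exact/homog_X/homog_cst.
Qed.

Lemma homog_sum (I : Type) (r : seq I) (P : pred I) d (F : I -> 'rV[R]_n -> R) :
  (forall a : I, P a -> homog d (F a)) -> homog d (fun z => \sum_(a <- r | P a) F a z).
Proof.
move=> h; elim: r => [|i r ih].
  by under eq_fun do rewrite big_nil; exact: homog_0.
under eq_fun do rewrite big_cons.
by case: (boolP (P i)) => // Pi; apply: homog_D => //; exact: h.
Qed.

Lemma homogX d p m : homog d p -> homog (d * m) (fun z => p z ^+ m).
Proof.
move=> hp; elim: m => [|m ih].
  by rewrite muln0; under eq_fun do rewrite expr0; exact: homog_cst.
by rewrite mulnS; under eq_fun do rewrite exprS; exact: homogM.
Qed.

Lemma homog_prod (I : Type) (r : seq I) (D : I -> nat) (F : I -> 'rV[R]_n -> R) :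
  (forall a : I, homog (D a) (F a)) ->
  homog (\sum_(a <- r) D a)%N (fun z => \prod_(a <- r) F a z).
Proof.
move=> h; elim: r => [|i r ih].
  rewrite big_nil (_ : (fun z => _) = (fun=> 1)); first exact: homog_cst.
  by apply/funext => z; rewrite big_nil.
rewrite big_cons.
rewrite (_ : (fun z => _) = (fun z => F i z * \prod_(a <- r) F a z)); first exact: homogM.
by apply/funext => z; rewrite big_cons.
Qed.

Lemma homog_mpow (m : 'I_n -> nat) : homog (mdeg m) (fun z => mpow z m).
Proof.
apply: (@homog_prod _ _ m) => i.
by have := homogX (m i) (homog_coord i); rewrite mul1n.
Qed.

Lemma homog_scale d p (t : R) z : homog d p -> p (t *: z) = t ^+ d * p z.
Proof.
move=> hp; elim: hp z => {d p} [c|d|d i p _ ih|d p q _ ihp _ ihq] z.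
- by rewrite expr0 mul1r.
- by rewrite mulr0.
- by rewrite ih mxE exprS; ring.
- by rewrite ihp ihq mulrDr.
Qed.

Lemma homogN d p z : homog d p -> p (- z) = (-1) ^+ d * p z.
Proof. by move=> hp; rewrite -scaleN1r (homog_scale _ _ hp). Qed.

Lemma homog_continuous d p : homog d p -> continuous p.
Proof.
elim=> {d p} [c|d|d i p _ ih|d p q _ ihp _ ihq] z.
- exact: cst_continuous.
- exact: cst_continuous.
- by apply: continuousM; [exact: (@coord_continuous R 1 n ord0 i) | exact: ih].
- by apply: continuousD; [exact: ihp | exact: ihq].
Qed.

Lemma homog_is_derive d p : homog d p ->
  forall z i, is_derive z (e_ i) p (partial i p z).
Proof.
elim=> {d p} [c|d|d i p _ ih|d p q _ ihp _ ihq] z j.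
- exact/derivableP/derivable_cst.
- exact/derivableP/derivable_cst.
- apply/derivableP/derivableM; last exact: (ih z j).(ex_derive).
  exact: (is_derive_coord z i j).(ex_derive).
- apply/derivableP/derivableD; [exact: (ihp z j).(ex_derive)|exact: (ihq z j).(ex_derive)].
Qed.

Lemma partial_cst i (c : R) : partial i (fun=> c) = (fun=> 0) :> ('rV[R]_n -> R).
Proof. by apply/funext => z; apply: partialE; exact: is_derive_cst. Qed.

Lemma partial_add d d' p q i : homog d p -> homog d' q ->
  partial i (fun z => p z + q z) = (fun z => partial i p z + partial i q z).
Proof.
move=> hp hq; apply/funext => z; apply: partialE; apply: is_deriveD.
- exact: homog_is_derive hp z i.
- exact: homog_is_derive hq z i.
Qed.

Lemma partial_mul d d' p q i : homog d p -> homog d' q ->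
  partial i (fun z => p z * q z) =
  (fun z => p z * partial i q z + q z * partial i p z).
Proof.
move=> hp hq; apply/funext => z; apply: partialE.
have hp' := homog_is_derive hp z i; have hq' := homog_is_derive hq z i.
exact: (@is_deriveM _ _ p q).
Qed.

Lemma partial_coord i j :
  partial i (fun z : 'rV[R]_n => z ord0 j) = (fun=> (j == i)%:R).
Proof. by apply/funext => z; apply: partialE; exact: is_derive_coord. Qed.

Lemma partial_X d p i j : homog d p ->
  partial i (fun z => z ord0 j * p z) =
  (fun z => z ord0 j * partial i p z + p z * (j == i)%:R).
Proof.
by move=> hp; rewrite (partial_mul _ (homog_coord j) hp) partial_coord.
Qed.

Lemma partial_homog0 p i : homog 0 p -> partial i p = (fun=> 0).
Proof.
move=> hp; have -> : p = fun=> p 0.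
  by apply/funext => z; rewrite -(scale0r z) (homog_scale _ _ hp) mul1r.
exact: partial_cst.
Qed.

Lemma homog_partial d p i : homog d p -> homog d.-1 (partial i p).
Proof.
elim=> {d p} [c|d|d j p hp ih|d p q hp ihp hq ihq].
- by rewrite partial_cst; exact: homog_0.
- by rewrite partial_cst; exact: homog_0.
- rewrite (partial_X _ _ hp) /=; apply: homog_D; last first.
    by under eq_fun do rewrite mulrC; exact: homogZ.
  case: d hp ih => [|d] hp ih; last exact: homog_X.
  by rewrite (partial_homog0 _ hp); under eq_fun do rewrite mulr0; exact: homog_0.
- by rewrite (partial_add _ hp hq); exact: homog_D.
Qed.

Lemma partial_comm d p i j : homog d p ->
  partial i (partial j p) = partial j (partial i p).
Proof.
elim=> {d p} [c|d|d k p hp ih|d p q hp ihp hq ihq].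
- by rewrite !partial_cst.
- by rewrite !partial_cst.
- have hm l : homog d (fun z => p z * (k == l)%:R).
    by under eq_fun do rewrite mulrC; exact: homogZ.
  have hx l : homog d.-1.+1 (fun z => z ord0 k * partial l p z).
    exact/homog_X/homog_partial.
  rewrite !(partial_X _ _ hp) !(partial_add _ (hx _) (hm _)).
  rewrite !(partial_X _ _ (homog_partial _ hp)) ih.
  rewrite !(partial_mul _ hp (homog_cst _)) !partial_cst.
  by apply/funext => z; ring.
- rewrite !(partial_add _ hp hq).
  by rewrite !(partial_add _ (homog_partial _ hp) (homog_partial _ hq)) ihp ihq.
Qed.

Lemma homog_euler d p z : homog d p ->
  \sum_(i < n) z ord0 i * partial i p z = d%:R * p z.
Proof.
move=> hp; elim: hp z => {d p} [c|d|d j p hp ih|d p q hp ihp hq ihq] z.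
- by rewrite big1 ?mul0r// => i _; rewrite partial_cst mulr0.
- by rewrite big1 ?mulr0// => i _; rewrite partial_cst mulr0.
- under eq_bigr do rewrite (partial_X _ _ hp) mulrDr mulrCA.
  rewrite big_split /= -mulr_sumr ih (bigD1 j)//= eqxx big1 => [|i /negPf ij].
    by rewrite (_ : true%:R = 1)// mulrS addr0 mulr1 mulrDl mul1r mulrCA addrC.
  by rewrite (eq_sym j) ij !mulr0.
- under eq_bigr do rewrite (partial_add _ hp hq) mulrDr.
  by rewrite big_split /= ihp ihq mulrDr.
Qed.

(** The square of [enorm], which unlike [enorm] is a polynomial. *)
Definition sqn z : R := \sum_(i < n) z ord0 i ^+ 2.

Lemma homog_sqn : homog 2 sqn.
Proof.
apply: homog_sum => i _; rewrite -[2%N]mul1n; exact/homogX/homog_coord.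
Qed.

Lemma partial_sqn i : partial i sqn = (fun z => 2 * z ord0 i).
Proof.
apply/funext => z; apply: partialE.
have -> : sqn = \sum_(j < n) (fun z => z ord0 j * z ord0 j).
  by apply/funext => y; rewrite fct_sumE.
have h j : is_derive z (e_ i) (fun z : 'rV[R]_n => z ord0 j * z ord0 j)
    (z ord0 j * (j == i)%:R + z ord0 j * (j == i)%:R).
  have hj := is_derive_coord z j i; exact: (is_deriveM hj hj).
apply: is_derive_eq (is_derive_sum h) _.
rewrite (bigD1 i)//= eqxx big1 => [|j /negPf ij]; last by rewrite ij mulr0 addr0.
by rewrite addr0 (_ : true%:R = 1)// mulr1 -mulr2n mulr_natl.
Qed.

Lemma sqn_ge0 z : 0 <= sqn z.
Proof. by apply: sumr_ge0 => i _; exact: sqr_ge0. Qed.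

Lemma sqr_enorm z : enorm z ^+ 2 = sqn z.
Proof. by rewrite sqr_sqrtr// sqn_ge0. Qed.

Lemma enorm_ge0 z : 0 <= enorm z.
Proof. exact: sqrtr_ge0. Qed.

Lemma sqn_eq0 z : (sqn z == 0) = (z == 0).
Proof.
apply/eqP/eqP => [/eqP|->]; last first.
  by rewrite /sqn big1// => i _; rewrite mxE expr0n.
rewrite psumr_eq0 => [/allP h|i _]; last exact: sqr_ge0.
apply/rowP => i; rewrite mxE; apply/eqP.
by move: (h i (mem_index_enum _)); rewrite sqrf_eq0.
Qed.

Lemma enorm_eq0 z : (enorm z == 0) = (z == 0).
Proof. by rewrite -sqrf_eq0 sqr_enorm sqn_eq0. Qed.

Lemma enorm0 : enorm (0 : 'rV[R]_n) = 0.
Proof. by apply/eqP; rewrite enorm_eq0. Qed.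

Lemma sqn0 : sqn 0 = 0.
Proof. by apply/eqP; rewrite sqn_eq0. Qed.

Lemma enorm_gt0 z : (0 < enorm z) = (z != 0).
Proof. by rewrite lt_def enorm_ge0 enorm_eq0 andbT. Qed.

Lemma sqn_gt0 z : (0 < sqn z) = (z != 0).
Proof. by rewrite lt_def sqn_ge0 sqn_eq0 andbT. Qed.

Lemma enormZ (t : R) z : enorm (t *: z) = `|t| * enorm z.
Proof.
rewrite /enorm -/(sqn (t *: z)) (homog_scale _ _ homog_sqn).
by rewrite sqrtrM ?sqr_ge0// sqrtr_sqr.
Qed.

Lemma enormN z : enorm (- z) = enorm z.
Proof. by rewrite -scaleN1r enormZ normrN1 mul1r. Qed.

Lemma coord_le_enorm z i : `|z ord0 i| <= enorm z.
Proof.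
rewrite -(@ler_pXn2r _ 2)// ?nnegrE ?enorm_ge0//.
rewrite sqr_enorm real_normK ?num_real// /sqn (bigD1 i)//= lerDl.
by apply: sumr_ge0 => j _; exact: sqr_ge0.
Qed.

Lemma homog_bound d p : homog d p ->
  exists2 C, 0 <= C & forall z, `|p z| <= C * enorm z ^+ d.
Proof.
elim=> {d p} [c|d|d j p hp [C C0 ih]|d p q hp [C C0 ihp] hq [D D0 ihq]].
- by exists `|c| => // z; rewrite expr0 mulr1.
- by exists 0 => // z; rewrite normr0 mul0r.
- exists C => // z; rewrite normrM exprS mulrCA ler_pM//.
  exact: coord_le_enorm.
- exists (C + D); first exact: addr_ge0.
  by move=> z; rewrite mulrDl (le_trans (ler_normD _ _))// lerD.
Qed.

Lemma enorm_continuous : continuous (@enorm R n).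
Proof.
move=> z; rewrite /enorm.
apply: (@continuous_comp _ _ _ sqn); first exact: homog_continuous homog_sqn z.
exact: sqrt_continuous.
Qed.

Lemma is_derive_enorm z i : z != 0 ->
  is_derive z (e_ i) (@enorm R n) (z ord0 i / enorm z).
Proof.
move=> z0; apply/is_derive_line.
have h1 := homog_is_derive homog_sqn z i.
move/is_derive_line : h1; rewrite partial_sqn => h1.
have h2 : is_derive (sqn (0 *: e_ i + z)) 1 (@Num.sqrt R) (2 * enorm z)^-1.
  by rewrite scale0r add0r; apply: is_derive1_sqrt; rewrite sqn_gt0.
apply: is_derive_eq; first exact: (is_derive1_comp h2 h1).
have : enorm z != 0 by rewrite enorm_eq0.
by move=> e0; field.
Qed.

Definition lap p z := \sum_(i < n) partial i (partial i p) z.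

Lemma homog_lap d p : homog d p -> homog d.-2 (lap p).
Proof. by move=> hp; apply: homog_sum => i _; exact/homog_partial/homog_partial. Qed.

Lemma partial_lap d p i : homog d p -> partial i (lap p) = lap (partial i p).
Proof.
move=> hp; apply/funext => z; apply: partialE.
have -> : lap p = \sum_(j < n) partial j (partial j p).
  by apply/funext => y; rewrite fct_sumE.
apply: is_derive_eq.
  apply: is_derive_sum => j.
  by apply: homog_is_derive; exact/homog_partial/homog_partial/hp.
apply: eq_bigr => j _.
by rewrite (partial_comm i j (homog_partial j hp)) (partial_comm i j hp).
Qed.

End homogeneous.

Local Opaque partial.

(** * Derivatives of the fundamental solution *)

Section kelvin.
Context {R : realType} {n : nat}.
Hypothesis n2 : (2 <= n)%N.
Implicit Types (z v : 'rV[R]_n) (p q : 'rV[R]_n -> R) (d : nat) (i j : 'I_n).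

Local Notation e_ i := (delta_mx ord0 i : 'rV[R]_n).

Lemma lap_mul d d' p q z : homog d p -> homog d' q ->
  lap (fun z => p z * q z) z =
  p z * lap q z + q z * lap p z + 2 * \sum_(i < n) partial i p z * partial i q z.
Proof.
move=> hp hq; rewrite /lap.
rewrite !mulr_sumr -!big_split; apply: eq_bigr => i _.
have hp' := homog_partial i hp; have hq' := homog_partial i hq.
rewrite (partial_mul _ hp hq) (partial_add _ (homogM hp hq') (homogM hq hp')).
rewrite (partial_mul i hp hq').
rewrite (partial_mul i hq hp').
move: (partial i (partial i p) z) (partial i (partial i q) z) => a b.
move: (partial i p z) (partial i q z) => c e.
by rewrite /=; ring.
Qed.

Lemma lap_add d d' p q z : homog d p -> homog d' q ->
  lap (fun z => p z + q z) z = lap p z + lap q z.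
Proof.
move=> hp hq; rewrite /lap -big_split; apply: eq_bigr => i _.
have hp' := homog_partial i hp; have hq' := homog_partial i hq.
by rewrite (partial_add _ hp hq) (partial_add _ hp' hq').
Qed.

Lemma lapZ d p (c : R) z : homog d p ->
  lap (fun z => c * p z) z = c * lap p z.
Proof.
move=> hp; rewrite (lap_mul _ (homog_cst c) hp).
rewrite (_ : lap (fun=> c) z = 0); last first.
  by rewrite /lap big1// => i _; rewrite !partial_cst.
rewrite mulr0 addr0 big1 ?mulr0 ?addr0// => i _.
by rewrite partial_cst mul0r.
Qed.

Lemma lap_sqn z : lap (@sqn R n) z = 2 * n%:R.
Proof.
rewrite /lap; under eq_bigr => i _.
  rewrite partial_sqn (partial_mul _ (homog_cst 2) (homog_coord i)) /=.
  rewrite partial_cst partial_coord eqxx mulr0 addr0 mulr1; over.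
by rewrite sumr_const card_ord mulr_natr.
Qed.

Lemma lap_sqn_mul d p z : homog d p ->
  lap (fun z => sqn z * p z) z = sqn z * lap p z + (2 * n%:R + 4 * d%:R) * p z.
Proof.
move=> hp; rewrite (lap_mul _ homog_sqn hp) lap_sqn.
rewrite (_ : \sum_(i < n) _ = 2 * (d%:R * p z)); first by ring.
rewrite -(homog_euler _ hp) mulr_sumr; apply: eq_bigr => i _.
by rewrite partial_sqn /= mulrA.
Qed.

Lemma lap_coord_mul d p i z : homog d p ->
  lap (fun z => z ord0 i * p z) z = z ord0 i * lap p z + 2 * partial i p z.
Proof.
move=> hp; rewrite (lap_mul _ (homog_coord i) hp).
rewrite (_ : lap (fun z => z ord0 i) z = 0); last first.
  by rewrite /lap big1// => j _; rewrite partial_coord partial_cst.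
rewrite mulr0 addr0; congr (_ + 2 * _).
rewrite (bigD1 i)//= partial_coord eqxx mul1r big1 ?addr0// => j /negPf ji.
by rewrite partial_coord eq_sym ji mul0r.
Qed.

(** Off the origin, [Y] is the Kelvin transform
    [Q (z / |z|^2) * |z|^(2 - n) = Q z / |z|^(n + 2k - 2)] of a harmonic
    homogeneous polynomial [Q] of degree [k]. *)
Definition kelvin (k : nat) (Y : 'rV[R]_n -> R) := exists Q, [/\ homog k Q,
  (forall z, lap Q z = 0) & forall z, z != 0 -> Y z = Q z / enorm z ^+ (n + k.*2 - 2)].

Lemma is_derive_enormVn z i (N : nat) : z != 0 ->
  is_derive z (e_ i) (fun z => (enorm z ^+ N)^-1) (- (N%:R * z ord0 i / enorm z ^+ N.+2)).
Proof.
move=> z0; have r0 : enorm z != 0 by rewrite enorm_eq0.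
have h := is_derive_enorm i z0.
have hN : is_derive z (e_ i) (fun z => enorm z ^+ N)
    ((N%:R * enorm z ^+ N.-1) *: (z ord0 i / enorm z)).
  by have := @is_deriveX _ _ _ N _ _ _ h; rewrite exprfctE.
have hf : enorm z ^+ N != 0 by rewrite expf_neq0.
pose g (y : 'rV[R]_n) : R := enorm y ^+ N.
have dg : derivable g z (e_ i) by exact: hN.(ex_derive).
have g0 : g z != 0 by exact: hf.
split; first exact: (@derivableV _ _ g z (e_ i) g0 dg).
have -> : 'D_(e_ i) (fun y : 'rV[R]_n => (enorm y ^+ N)^-1) z = - (g z) ^- 2 *: 'D_(e_ i) g z.
  exact: (@deriveV _ _ g z (e_ i) g0 dg).
rewrite (_ : 'D_(e_ i) g z = (N%:R * enorm z ^+ N.-1) *: (z ord0 i / enorm z));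
  last exact: hN.(derive_val).
rewrite {dg g0}/g; move: hN hf => _.
move: (enorm z) (z ord0 i) r0 => r x r0.
case: N => [|N] hf; first by rewrite !mul0r scale0r scaler0 oppr0.
rewrite /= /GRing.scale /= !exprS; have hf2 : r ^+ N != 0 by rewrite expf_neq0.
by field; rewrite r0 hf2.
Qed.

Lemma near_neq0 z : z != 0 -> \forall y \near z, y != 0.
Proof.
move=> z0; have r0 : enorm z != 0 by rewrite enorm_eq0.
apply: filterS (cvgr_neq0 _ (@enorm_continuous R n z) r0) => y.
by rewrite enorm_eq0.
Qed.

(** Differentiating [Q / |z|^N] with [N = n + 2k - 2] produces the numerator
    [|z|^2 D_i Q - N z_i Q] over [|z|^(N + 2)]. It is harmonic, because
    [lap (|z|^2 D_i Q) = (2n + 4(k - 1)) D_i Q] by Euler's identity,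
    [lap (z_i Q) = 2 D_i Q], and [2n + 4(k - 1) = 2N]. *)
Lemma kelvin_partial k Y i : kelvin k Y -> kelvin k.+1 (partial i Y).
Proof.
move=> [Q [hQ lQ YQ]].
have hsQ : homog k.+1 (fun z => sqn z * partial i Q z).
  clear YQ; case: k hQ => [|k] hQ.
    by rewrite (partial_homog0 _ hQ); under eq_fun do rewrite mulr0; exact: homog_0.
  by rewrite -add2n; exact: homogM homog_sqn (homog_partial i hQ).
(* for k = 0 both sides vanish, as D_i Q = 0, although k.-1 is not k - 1 *)
have hk z : k.-1%:R * partial i Q z = (k%:R - 1) * partial i Q z.
  clear YQ hsQ; case: k hQ => [|k] hQ; first by rewrite (partial_homog0 _ hQ) !mulr0.
  by rewrite -[k.+1%:R]natr1 addrK.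
set N := (n + k.*2 - 2)%N in YQ.
have hN : N%:R = n%:R + 2 * k%:R - 2 :> R.
  by rewrite natrB ?natrD ?(leq_trans n2) ?leq_addr// -mul2n natrM.
have hxQ : homog k.+1 (fun z => z ord0 i * Q z) by exact: homog_X.
exists (fun z => sqn z * partial i Q z + - N%:R * (z ord0 i * Q z)); split.
- exact/homog_D/homogZ.
- move=> z; rewrite (lap_add _ hsQ (homogZ _ hxQ)) (lapZ _ _ hxQ).
  rewrite (lap_coord_mul _ _ hQ) (lap_sqn_mul _ (homog_partial i hQ)).
  rewrite -(partial_lap _ hQ) (_ : lap Q = fun=> 0) ?partial_cst; last exact/funext.
  rewrite mulr0 add0r mulrDl -(mulrA 4) hk hN mulr0 add0r.
  by move: (partial i Q z) => u; ring.
- move=> z z0; apply: partialE.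
  apply: (near_eq_is_derive (f := fun z => Q z * (enorm z ^+ N)^-1)).
    by apply: filterS (near_neq0 z0) => y /YQ.
  have r0 : enorm z != 0 by rewrite enorm_eq0.
  have h1 := homog_is_derive hQ z i; have h2 := is_derive_enormVn i N z0.
  apply: is_derive_eq (is_deriveM h1 h2) _.
  rewrite (_ : (n + k.+1.*2 - 2 = N.+2)%N); last first.
    by rewrite doubleS !addnS !subSS subn0 /N -addn2 subnK// (leq_trans n2)// leq_addr.
  rewrite -sqr_enorm /GRing.scale/= !exprS.
  move: (partial i Q z) (Q z) (enorm z) (z ord0 i) r0 => u q r x r0.
  have hf2 : r ^+ N != 0 by rewrite expf_neq0.
  by field; rewrite r0 hf2.
Qed.

Lemma kelvin_Gamma : kelvin 0 (@Gamma R n).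
Proof.
exists (fun=> (n%:R * (2 - n%:R) * @unit_ball_volume R n)^-1); split.
- exact: homog_cst.
- by move=> z; rewrite /lap big1// => i _; rewrite !partial_cst.
- move=> z z0; rewrite /Gamma addn0; congr (_ * _).
  have -> : 2 - n%:Z = - (n - 2)%N%:Z by rewrite -subzn// opprB.
  by rewrite -exprz_inv -exprnP exprVn.
Qed.

Lemma kelvin_mpartial_Gamma (b : 'I_n -> nat) :
  kelvin (mdeg b) (mpartial b (@Gamma R n)).
Proof.
rewrite /mdeg -big_enum /= /mpartial.
have -> : \sum_(i <- enum 'I_n) b i = (\sum_(i <- enum 'I_n) b i + 0)%N by rewrite addn0.
elim: (enum 'I_n) => [|i s ih] /=; first by rewrite big_nil; exact: kelvin_Gamma.
rewrite big_cons -addnA; elim: (b i) => //= m.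
by rewrite addSn; exact: kelvin_partial.
Qed.

End kelvin.

(** * Lebesgue measure and affine changes of variable *)

Section measure_rV.
Context {R : realType}.

(** An open set is the union of the countably many cubes with rational centre
    and radius [1 / (m + 1)] that it contains; cubes belong to the product
    sigma-algebra. *)
Lemma open_measurable_rV n (U : set 'rV[R]_n) : open U -> measurable U.
Proof.
move=> oU.
pose B (p : 'rV[rat]_n * nat) : set 'rV[R]_n :=
  [set y | forall i, `|y ord0 i - ratr (p.1 ord0 i)| < p.2.+1%:R^-1].
have mB p : measurable (B p).
  rewrite (_ : B p = \bigcap_(i in [set: 'I_n])
      ((fun v : 'rV[R]_n => v ord0 i) @^-1`
      `]ratr (p.1 ord0 i) - p.2.+1%:R^-1, ratr (p.1 ord0 i) + p.2.+1%:R^-1[)).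
    apply: fin_bigcap_measurable => // i _; rewrite -[X in measurable X]setTI.
    exact: measurable_coord_rV.
  apply/seteqP; split => y /= h i; first by move=> _; rewrite /= in_itv/= -ltr_distl.
  by have := h i Logic.I; rewrite /= in_itv/= -ltr_distl.
rewrite (_ : U = \bigcup_(p : 'rV[rat]_n * nat) (if `[< B p `<=` U >] then B p else set0)).
  apply: countable_bigcupT_measurable => [|p]; first exact: countableP.
  by case: ifP.
apply/seteqP; split => [x Ux|x [p _]]; last first.
  by case: ifPn => // /asboolP BU Bx; exact: BU.
have /nbhs_ballP[e /= e0 xeU] : nbhs x U by exact: open_nbhs_nbhs.
pose m := Num.truncn (2 / e).
have me : m.+1%:R^-1 < e / 2.
  rewrite invf_plt ?posrE ?divr_gt0// invf_div.
  by have := truncnS_gt (2 / e); rewrite -/m.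
have hq i : exists q : rat, `|x ord0 i - ratr q| < m.+1%:R^-1.
  have : x ord0 i - m.+1%:R^-1 < x ord0 i + m.+1%:R^-1.
    by rewrite ltrD2l gtrN// invr_gt0 ltr0n.
  move=> /rat_in_itvoo[q]; rewrite in_itv/= -ltr_distl distrC => h; by exists q.
pose q := \row_i projT1 (cid (hq i)).
have Bx : B (q, m) x by move=> i /=; rewrite mxE; case: cid.
exists (q, m) => //; rewrite asboolT// => y By; apply: xeU; split => // i j.
rewrite (ord1 i) /ball/=.
rewrite -(subrKA (ratr (q ord0 j))) (le_lt_trans (ler_normD _ _))//.
rewrite (_ : e = e / 2 + e / 2); last by rewrite -splitr.
rewrite ltrD// (lt_trans _ me)//.
by rewrite distrC; exact: (By j).
Qed.

Lemma continuous_measurable_rV n (f : 'rV[R]_n -> R) :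
  continuous f -> measurable_fun setT f.
Proof.
move=> cf; apply: (measurability _ (RGenOInfty.measurableE R)) => _ [_ [x ->] <-].
rewrite setTI; apply: open_measurable_rV.
by apply: open_comp => // y _; exact: cf.
Qed.

Local Notation mu := (@lebesgue_measure R).
Local Open Scope ereal_scope.

(** The image of Lebesgue measure under [t |-> a t + b], scaled by [|a|],
    agrees with Lebesgue measure on half-open intervals, hence everywhere. *)
Lemma ge0_integral_affine1 (F : R -> \bar R) (a b : R) : a != 0%R ->
  measurable_fun setT F -> (forall x, 0 <= F x) ->
  \int[mu]_t F (a * t + b)%R = (`|a|^-1)%:E * \int[mu]_t F t.
Proof.
move=> a0 mF F0.
pose phi (t : measurableTypeR R) : measurableTypeR R := (a * t + b)%R.
have mphi : measurable_fun setT phi.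
  by apply: measurable_funD => //; apply: measurable_funM.
have na0 : (0 < `|a|)%R by rewrite normr_gt0.
pose ra : {nonneg R} := NngNum (normr_ge0 a).
pose nu := mscale ra
  (measure_function_pushforward__canonical__measure_function_Measure mu mphi).
have H (X : set R) : measurable X -> mu X = nu X.
  apply: lebesgue_measure_unique => _ [[c d] _ <-] /=.
  rewrite /mscale /= /pushforward.
  have [a1|a1] : (0 < a)%R \/ (a < 0)%R by move: a0; rewrite neq_lt => /orP[]; tauto.
  - rewrite (_ : phi @^-1` _ = `]((c - b) / a)%R, ((d - b) / a)%R]%classic); last first.
      apply/seteqP; split => t /=; rewrite !in_itv/= /phi ltr_pdivrMr// ler_pdivlMr//;
        by rewrite ltrBlDr lerBrDr mulrC.
    rewrite !lebesgue_measure_itv/= !lte_fin ltr_pM2r ?invr_gt0// ltrD2r.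
    case: ifPn => _; last by rewrite mule0.
    by rewrite -!EFinD -EFinM gtr0_norm// -mulrBl; congr EFin; field.
  - rewrite (_ : phi @^-1` _ = `[((d - b) / a)%R, ((c - b) / a)%R[%classic); last first.
      apply/seteqP; split => t /=; rewrite !in_itv/= /phi ltr_ndivlMr// ler_ndivrMr//;
        rewrite ltrBlDr lerBrDr mulrC => /andP[-> ->]//.
    rewrite !lebesgue_measure_itv/= !lte_fin ltr_nM2r ?invr_lt0// ltrD2r.
    case: ifPn => _; last by rewrite mule0.
    by rewrite -!EFinD -EFinM ltr0_norm// -mulrBl; congr EFin; field.
have -> : \int[mu]_t F t = \int[nu]_t F t.
  by apply: eq_measure_integral => A mA _; exact: H.
rewrite ge0_integral_mscale// ge0_integral_pushforward//.
by rewrite preimage_setT muleA -EFinM mulVf ?gt_eqF// mul1e.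
Qed.

Lemma ge0_integral_rVS n (F : 'rV[R]_n.+1 -> \bar R) :
  measurable_fun setT F -> (forall x, 0 <= F x) ->
  \int[lebesgue_rV n.+1]_y F y = \int[lebesgue_rV n]_u \int[mu]_t F (cons_rV (u, t)).
Proof.
move=> mF F0; rewrite /= /product_rV.
rewrite ge0_integral_pushforward//; last exact: measurable_cons_rV.
rewrite preimage_setT fubini_tonelli1//; last by move=> x; exact: F0.
by apply: measurableT_comp => //; exact: measurable_cons_rV.
Qed.

Lemma cons_rVl n (u : 'rV[R]_n) (t : R) : cons_rV (u, t) ord0 (lshift n (ord0 : 'I_1)) = t.
Proof. by apply: etrans (row_mxEl _ _ _ _) _; rewrite mxE. Qed.

Lemma cons_rVr n (u : 'rV[R]_n) (t : R) j : cons_rV (u, t) ord0 (rshift 1 j) = u ord0 j.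
Proof. exact: row_mxEr. Qed.

Lemma rV0E (v w : 'rV[R]_0) : v = w.
Proof. by apply/rowP => -[]. Qed.

Lemma measurable_affine_rV n (a : R) (v : 'rV[R]_n) :
  measurable_fun setT (fun y : 'rV[R]_n => a *: y + v)%R.
Proof.
apply: measurable_fun_rV => i.
rewrite (_ : (fun _ => _) = (fun y : 'rV[R]_n => a * y ord0 i + v ord0 i)%R); last first.
  by apply/funext => y; rewrite !mxE.
by apply: measurable_funD => //; apply: measurable_funM => //; exact: measurable_coord_rV.
Qed.

(** Induction on the dimension: the change of variable acts on each coordinate
    separately. *)
Lemma ge0_integral_affine n (F : 'rV[R]_n -> \bar R) (a : R) (v : 'rV[R]_n) :
  a != 0%R -> measurable_fun setT F -> (forall x, 0 <= F x) ->
  \int[lebesgue_rV n]_y F (a *: y + v)%R = (`|a| ^- n)%:E * \int[lebesgue_rV n]_y F y.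
Proof.
move=> a0; elim: n F v => [|n ih] F v mF F0.
  rewrite invr1 mul1e; apply: eq_integral => y _; congr F; exact: rV0E.
have mF' : measurable_fun setT (fun y : 'rV[R]_n.+1 => F (a *: y + v)%R).
  by apply: measurableT_comp => //; exact: measurable_affine_rV.
rewrite !ge0_integral_rVS//.
pose v' : 'rV[R]_n := rsubmx (v : 'rV[R]_(1 + n)).
have E u t : (a *: cons_rV (u, t) + v = cons_rV (a *: u + v', a * t + v ord0 ord0))%R.
  have lin (m : nat) (A B : 'rV[R]_m) i : ((a *: A + B) ord0 i = a * A ord0 i + B ord0 i)%R.
    by rewrite !mxE.
  apply/rowP => i; rewrite lin; case: (split_ordP (i : 'I_(1 + n))) => j ->.
    rewrite (ord1 j) !cons_rVl; congr (_ + v _ _)%R; exact/val_inj.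
  by rewrite !cons_rVr lin mxE.
pose G u := \int[mu]_t F (cons_rV (u, t)).
have mFc : measurable_fun setT (F \o @cons_rV R n).
  by apply: measurableT_comp => //; exact: measurable_cons_rV.
have mG : measurable_fun setT G.
  exact: (@measurable_fun_fubini_tonelli_F _ _ _ _ R mu
    (F \o @cons_rV R n) mFc (fun x => F0 _)).
have G0 u : 0 <= G u by exact: integral_ge0.
transitivity (\int[lebesgue_rV n]_u ((`|a|^-1)%:E * G (a *: u + v')%R)).
  apply: eq_integral => u _; under eq_integral do rewrite E.
  rewrite (@ge0_integral_affine1 (fun t => F (cons_rV ((a *: u + v')%R, t))))//.
  apply: (measurableT_comp mFc).
  exact: measurable_pair1.
rewrite ge0_integralZl//; last exact: (measurableT_comp mG (measurable_affine_rV a v')).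
by rewrite ih// muleA -EFinM exprS invfM.
Qed.

Definition box n (M : R) : set 'rV[R]_n := [set y | forall i, (`|y ord0 i| <= M)%R].

Lemma measurable_box n M : measurable (@box n M).
Proof.
rewrite (_ : @box n M = \bigcap_(i in [set: 'I_n])
  ((fun v : 'rV[R]_n => v ord0 i) @^-1` `[(- M)%R, M]%classic)).
  apply: fin_bigcap_measurable => // i _; rewrite -[X in measurable X]setTI.
  exact: measurable_coord_rV.
apply/seteqP; split => y /= h i; first by move=> _; rewrite /= in_itv/= -ler_norml.
by have := h i Logic.I; rewrite /= in_itv/= -ler_norml.
Qed.

Lemma lebesgue_rV_box n (M : R) : lebesgue_rV n (box M) < +oo.
Proof.
elim: n => [|n ih]; first by rewrite /= diracE ltry.
rewrite /= /product_rV /pushforward.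
rewrite (_ : _ @^-1` _ = @box n M `*` `[(- M)%R, M]%classic).
  have mI : measurable (`[(- M)%R, M]%classic : set (measurableTypeR R)) by [].
  have mb := @measurable_box n M.
  rewrite product_measure1E// lte_mul_pinfty//.
    by rewrite ge0_fin_numE.
  by rewrite /= lebesgue_measure_itv/=; case: ifP => _; rewrite ?ltry// -EFinD ltry.
apply/seteqP; split => [[u t]|[u t]] /= h.
  split => [i|].
    by have := h (rshift 1 i); rewrite cons_rVr.
  have := h (lshift n (ord0 : 'I_1)); rewrite cons_rVl /=.
  by rewrite in_itv/= -ler_norml.
move=> i; case: (split_ordP (i : 'I_(1 + n))) => j ->.
  by rewrite (ord1 j) cons_rVl/= ler_norml; case: h => _; rewrite in_itv.
by rewrite cons_rVr; exact: h.1.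
Qed.

End measure_rV.

(** * Integrals over the whole space *)

Section integral_rV.
Context {R : realType}.
Local Notation lam n := (@lebesgue_rV R n).

Lemma integrable_box n M : (lam n).-integrable setT (fun x => (\1_(@box R n M) x)%:E).
Proof.
have mb := @measurable_box R n M.
apply/integrableP; split; first exact/measurable_EFinP.
rewrite (eq_integral (fun x => (\1_(@box R n M) x)%:E)); last first.
  by move=> t _; rewrite gee0_abs// lee_fin.
by rewrite integral_indic// setIT; exact: lebesgue_rV_box.
Qed.

Lemma integrable_bounded n (F : 'rV[R]_n -> R) (C M : R) :
  measurable_fun setT F -> (forall z, `|F z| <= C) ->
  (forall z, ~ box M z -> F z = 0) ->
  (lam n).-integrable setT (EFin \o F).
Proof.
move=> mF FC FM.
apply: (@le_integrable _ _ _ (lam n) setT measurableT _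
  (fun x => C%:E * (\1_(@box R n M) x)%:E)%E).
- exact/measurable_EFinP.
- move=> z _; rewrite -EFinM !abse_EFin lee_fin indicE.
  case: (boolP (z \in box M)) => [zb|/negP zM].
    by rewrite mulr1 (le_trans (FC z))// ler_norm.
  by rewrite FM ?mulr0 ?normr0// => zb; apply: zM; rewrite inE.
- by apply: integrableZl => //; exact: integrable_box.
Qed.

Lemma integrable_affine n (F : 'rV[R]_n -> R) (a : R) v : a != 0 ->
  (lam n).-integrable setT (EFin \o F) ->
  (lam n).-integrable setT (EFin \o (fun y => F (a *: y + v))).
Proof.
move=> a0 /integrableP[mF iF]; apply/integrableP; split.
  exact: (measurableT_comp mF (measurable_affine_rV a v)).
rewrite (@ge0_integral_affine _ _ (fun y => `|(F y)%:E|%E))//.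
  rewrite lte_mul_pinfty// ?lee_fin ?invr_ge0 ?exprn_ge0//.
exact: measurableT_comp.
Qed.

Lemma Rintegral_affine n (F : 'rV[R]_n -> R) (a : R) v : a != 0 ->
  (lam n).-integrable setT (EFin \o F) ->
  \int[lam n]_y F (a *: y + v) = `|a| ^- n * \int[lam n]_y F y.
Proof.
move=> a0 iF; have [mF _] := integrableP _ _ _ iF.
rewrite /Rintegral.
have -> : (\int[lam n]_y (F (a *: y + v))%:E = (`|a| ^- n)%:E * \int[lam n]_y (F y)%:E)%E.
  rewrite integralE [in RHS]integralE muleBr//; last first.
    by rewrite fin_num_adde_defl// fin_numN; exact: (integrable_neg_fin_num measurableT iF).
  congr (_ - _)%E.
    rewrite -(@ge0_integral_affine _ _ (EFin \o F)^\+%E a v a0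
      (measurable_funepos mF) (funepos_ge0 _)).
    by apply: eq_integral => y _; rewrite !funeposE.
  rewrite -(@ge0_integral_affine _ _ (EFin \o F)^\-%E a v a0
    (measurable_funeneg mF) (funeneg_ge0 _)).
  by apply: eq_integral => y _; rewrite !funenegE.
by rewrite fineM//; exact: (integrable_fin_num measurableT iF).
Qed.

Lemma Rintegral_shift n (F : 'rV[R]_n -> R) v :
  (lam n).-integrable setT (EFin \o F) ->
  \int[lam n]_y F (y + v) = \int[lam n]_y F y.
Proof.
move=> iF; have := Rintegral_affine v (oner_neq0 R) iF.
by rewrite normr1 expr1n invr1 mul1r => <-; apply: eq_Rintegral => y _; rewrite scale1r.
Qed.

Lemma Rintegral_opp n (F : 'rV[R]_n -> R) v :
  (lam n).-integrable setT (EFin \o F) ->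
  \int[lam n]_y F (v - y) = \int[lam n]_y F y.
Proof.
move=> iF; have n1 : (-1 : R) != 0 by rewrite oppr_eq0 oner_eq0.
have := Rintegral_affine v n1 iF.
rewrite normrN1 expr1n invr1 mul1r => <-; apply: eq_Rintegral => y _.
by rewrite scaleN1r addrC.
Qed.

Lemma is_derive_lipschitz n (F F' : 'rV[R]_n -> R) (v : 'rV[R]_n) (C : R) :
  (forall z, is_derive z v F (F' z)) -> (forall z, `|F' z| <= C) ->
  forall (z : 'rV[R]_n) (t : R), 0 <= t -> `|F (t *: v + z) - F z| <= C * t.
Proof.
move=> dF FC z t t0; pose g (s : R) := F (s *: v + z).
have dg (s : R) : is_derive s (1 : R) g (F' (s *: v + z)) by exact/is_derive_line_at.
have cg : {within `[0, t], continuous g}.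
  apply: continuous_subspaceT => s.
  by apply/differentiable_continuous/derivable1_diffP; exact: (dg s).(ex_derive).
have [c _] := MVT_segment t0 (fun s _ => dg s) cg.
rewrite /g scale0r add0r subr0 => ->.
by rewrite normrM (ger0_norm t0) ler_wpM2r.
Qed.

(** The divergence theorem for compactly supported fields. By translation
    invariance the difference quotients of [F] in the direction [i] have
    integral 0; they are bounded by [C], supported in one box, and converge to
    [F'], so dominated convergence applies. *)
Lemma Rintegral_partial0 n (F F' : 'rV[R]_n -> R) i (C M : R) :
  (forall z, is_derive z (delta_mx ord0 i) F (F' z)) ->
  measurable_fun setT F -> measurable_fun setT F' ->
  (forall z, `|F z| <= C) -> (forall z, `|F' z| <= C) ->
  (forall z, ~ box M z -> F z = 0) ->
  \int[lam n]_z F' z = 0.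
Proof.
move=> dF mF mF' FC F'C FM.
set e : 'rV[R]_n := delta_mx ord0 i.
have iF := integrable_bounded mF FC FM.
pose t k : R := k.+1%:R^-1.
have t0 k : 0 < t k by rewrite invr_gt0 ltr0n.
pose g k z := (t k)^-1 * (F (t k *: e + z) - F z).
have mg k : measurable_fun setT (g k).
  apply: measurable_funM => //; apply: measurable_funB => //.
  have := measurableT_comp mF (measurable_affine_rV 1 (t k *: e)).
  by under eq_fun do rewrite /= scale1r addrC.
have iFs k : (lam n).-integrable setT (EFin \o (fun z => F (t k *: e + z))).
  have := integrable_affine (t k *: e) (oner_neq0 R) iF.
  by apply: eq_integrable => // y _ /=; rewrite scale1r addrC.
have Ig k : \int[lam n]_z g k z = 0.
  rewrite RintegralZl//; last exact: (integrableB measurableT (iFs k) iF).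
  rewrite RintegralB// -(Rintegral_shift (t k *: e) iF).
  under [X in _ * (X - _)]eq_Rintegral do rewrite addrC.
  by rewrite subrr mulr0.
have gF z : g ^~ z @ \oo --> F' z.
  have [dFz <-] := dF z.
  have tc : t k @[k --> \oo] --> (0 : R) by exact: (@cvg_harmonic R).
  have tn0 k : t k != 0 by rewrite gt_eqF.
  exact: ((cvgr_dnbhsP _ 0 _).1 dFz t (conj tn0 tc)).
have gC k z : `|g k z| <= C.
  rewrite normrM ger0_norm; last by rewrite invr_ge0 ltW.
  rewrite ler_pdivrMl// mulrC.
  exact: (is_derive_lipschitz dF F'C _ (ltW (t0 k))).
(* the translation vector has length t k <= 1, which enlarges the box by 1 *)
have gM k z : ~ box (M + 1) z -> g k z = 0.
  move=> zM; rewrite /g !FM ?subrr ?mulr0//; apply: contra_not zM => zb j.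
    by rewrite (le_trans (zb j))// lerDl.
  have := zb j; rewrite !mxE eqxx/= => h.
  have tk1 : t k <= 1 by rewrite invf_le1// ler1n.
  rewrite -[X in `|X|](addKr (t k * (j == i)%:R)) (le_trans (ler_normD _ _))//.
  rewrite addrC lerD// normrN normrM (ger0_norm (ltW (t0 k))) normr_nat.
  by rewrite mulr_ile1 ?ler0n ?lern1 ?leq_b1// ltW.
pose G z : \bar R := (C%:E * (\1_(@box R n (M + 1)) z)%:E)%E.
have iG : (lam n).-integrable setT G by apply: integrableZl => //; exact: integrable_box.
have gG z k : (`|(g k z)%:E| <= G z)%E.
  rewrite /G -EFinM abse_EFin lee_fin indicE.
  case: (boolP (z \in box (M + 1))) => [zb|/negP zM]; first by rewrite mulr1.
  by rewrite gM ?mulr0 ?normr0// => zb; apply: zM; rewrite inE.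
have gF' z : (fun k => (g k z)%:E) @ \oo --> (F' z)%:E.
  by apply: cvg_EFin; [exact: nearW | exact: gF].
have mg' k : measurable_fun setT (EFin \o g k) by exact/measurable_EFinP.
have mF'' : measurable_fun setT (EFin \o F') by exact/measurable_EFinP.
have [_ _] := @dominated_convergence _ _ _ (lam n) setT measurableT
  (fun k => EFin \o g k) (EFin \o F') G
  mg' mF'' (aeW _ (fun z _ => gF' z))
  iG (aeW _ (fun z k _ => gG z k)).
have -> : (fun k => \int[lam n]_z (EFin \o g k) z)%E = fun=> 0%E.
  apply/funext => k; have := Ig k; rewrite /Rintegral => /eqP.
  rewrite fine_eq0; last first.
    apply: (integrable_fin_num measurableT); apply: (le_integrable measurableT _ _ iG).
      exact/measurable_EFinP.
    by move=> z _; rewrite (le_trans (gG z k))// lee_abs.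
  by move/eqP.
move=> /cvg_lim h; rewrite /Rintegral -h//.
by rewrite lim_cst.
Qed.

End integral_rV.

(** * Orthogonality of harmonic polynomials to lower degrees *)

Section orthogonality.
Context {R : realType} {n : nat}.
Local Notation lam := (@lebesgue_rV R n).
Implicit Types (z : 'rV[R]_n) (p Q : 'rV[R]_n -> R) (w : R -> R).

Lemma Rintegral_sum (I : Type) (r : seq I) (F : I -> 'rV[R]_n -> R) :
  (forall a, lam.-integrable setT (EFin \o F a)) ->
  lam.-integrable setT (EFin \o (fun z => \sum_(a <- r) F a z)) /\
  \int[lam]_z (\sum_(a <- r) F a z) = \sum_(a <- r) \int[lam]_z F a z.
Proof.
move=> iF; elim: r => [|a r [ih1 ih2]].
  under [X in EFin \o X]eq_fun do rewrite big_nil.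
  under eq_Rintegral do rewrite big_nil.
  split; first exact: integrable0.
  by rewrite big_nil /Rintegral integral0.
under [X in EFin \o X]eq_fun do rewrite big_cons.
under eq_Rintegral do rewrite big_cons.
split; first exact: (integrableD measurableT (iF a) ih1).
by rewrite RintegralD// ih2 big_cons.
Qed.

(** Radial weights, as functions of [s = |z|^2] given with their derivative:
    of class C^1, and zero outside the ball [|z| < 2]. *)
Definition C1c w w' := [/\ forall s : R, is_derive s (1 : R) w (w' s), continuous w',
  forall s, 4 <= s -> w s = 0 & forall s, 4 <= s -> w' s = 0].

Lemma C1c_continuous w w' : C1c w w' -> continuous w.
Proof.
move=> [dw _ _ _] s.
by apply/differentiable_continuous/derivable1_diffP; exact: (dw s).(ex_derive).
Qed.

Lemma C1c_X w w' : C1c w w' -> C1c (fun s => s * w s) (fun s => s * w' s + w s).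
Proof.
move=> hw; have cw := C1c_continuous hw; have [dw cw' w4 w'4] := hw; split.
- move=> s; apply: is_derive_eq (is_deriveM (is_derive_id s 1) (dw s)) _.
  by rewrite /GRing.scale/= mulr1.
- move=> s; apply: (@continuousD _ _ _ (fun s : R => s * w' s) w); last exact: cw.
  by apply: (@continuousM _ _ id w'); [exact: cvg_id | exact: cw'].
- by move=> s s4; rewrite w4// mulr0.
- by move=> s s4; rewrite w4// w'4// mulr0 addr0.
Qed.

Lemma homog_cutoff_continuous d Q (v : R -> R) : homog d Q -> continuous v ->
  continuous (fun z => Q z * v (sqn z)).
Proof.
move=> hQ cv z; apply: continuousM; first exact: homog_continuous hQ z.
apply: continuous_comp; first exact: homog_continuous homog_sqn z.
exact: cv.
Qed.

Lemma homog_cutoff_bound d Q (v : R -> R) : homog d Q -> continuous v ->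
  (forall s, 4 <= s -> v s = 0) -> exists C : R, forall z, `|Q z * v (sqn z)| <= C.
Proof.
move=> hQ cv v4; have [C C0 hC] := homog_bound hQ.
have cn : {within `[0, 4], continuous (fun s => `|v s|)}.
  by apply: continuous_subspaceT => s; apply: cvg_norm; exact: cv.
have [c _ hc] := EVT_max (ler0n R 4) cn.
exists (C * 2 ^+ d * `|v c|) => z.
have [s4|s4] := leP 4 (sqn z).
  by rewrite v4// mulr0 normr0 mulr_ge0// mulr_ge0// exprn_ge0.
rewrite normrM ler_pM//; last by apply: hc; rewrite in_itv/= sqn_ge0 ltW.
rewrite (le_trans (hC z))// ler_wpM2l// lerXn2r ?nnegrE ?enorm_ge0//.
rewrite -(@ler_pXn2r _ 2)// ?nnegrE ?enorm_ge0//.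
by rewrite sqr_enorm expr2 -natrM ltW.
Qed.

Lemma sqn_box z : ~ box 2 z -> 4 <= sqn z.
Proof.
move=> h; rewrite leNgt; apply/negP => s4; apply: h => i.
apply: le_trans (coord_le_enorm z i) _.
rewrite -(@ler_pXn2r _ 2)// ?nnegrE ?enorm_ge0//.
by rewrite sqr_enorm expr2 -natrM ltW.
Qed.

Lemma homog_cutoff_integrable d Q (v : R -> R) : homog d Q -> continuous v ->
  (forall s, 4 <= s -> v s = 0) ->
  lam.-integrable setT (EFin \o (fun z => Q z * v (sqn z))).
Proof.
move=> hQ cv v4; have [C hC] := homog_cutoff_bound hQ cv v4.
apply: (@integrable_bounded _ _ _ C 2) => //.
  exact: continuous_measurable_rV (homog_cutoff_continuous hQ cv).
by move=> z /sqn_box zM; rewrite v4// mulr0.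
Qed.

Lemma is_derive_cutoff Q d w w' i z : homog d Q -> C1c w w' ->
  is_derive z (delta_mx ord0 i) (fun z => Q z * w (sqn z))
    (partial i Q z * w (sqn z) + 2 * (z ord0 i * Q z * w' (sqn z))).
Proof.
move=> hQ [dw _ _ _]; have h1 := homog_is_derive hQ z i.
have h2 : is_derive z (delta_mx ord0 i) (fun z => w (sqn z)) (w' (sqn z) * (2 * z ord0 i)).
  apply/is_derive_line.
  have := (is_derive_line _ _ _ _).1 (homog_is_derive homog_sqn z i).
  rewrite partial_sqn => h3.
  have h4 : is_derive (sqn (0 *: delta_mx ord0 i + z)) 1 w (w' (sqn z)).
    by rewrite scale0r add0r; exact: dw.
  exact: (is_derive1_comp h4 h3).
apply: is_derive_eq (is_deriveM h1 h2) _.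
by rewrite /GRing.scale/=; ring.
Qed.

(** The integrand is the [i]-th partial derivative of [Q z * w (|z|^2)]. *)
Lemma integral_div0 d Q w w' i : homog d Q -> C1c w w' ->
  \int[lam]_z (partial i Q z * w (sqn z) + 2 * (z ord0 i * Q z * w' (sqn z))) = 0.
Proof.
move=> hQ hw; have cw := C1c_continuous hw; have [dw cw' w4 w'4] := hw.
have hQ' := homog_partial i hQ; have hX := homog_X i hQ.
have [C hC] := homog_cutoff_bound hQ cw w4.
have [C1 hC1] := homog_cutoff_bound hQ' cw w4.
have [C2 hC2] := homog_cutoff_bound hX cw' w'4.
apply: (@Rintegral_partial0 _ _ (fun z => Q z * w (sqn z)) _ i (Num.max C (C1 + 2 * C2)) 2).
- by move=> z; exact: (is_derive_cutoff i z hQ hw).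
- exact: continuous_measurable_rV (homog_cutoff_continuous hQ cw).
- apply: measurable_funD.
    exact: continuous_measurable_rV (homog_cutoff_continuous hQ' cw).
  apply: measurable_funM => //.
  exact: continuous_measurable_rV (homog_cutoff_continuous hX cw').
- by move=> z; rewrite le_max hC.
- move=> z; rewrite le_max; apply/orP; right.
  rewrite (le_trans (ler_normD _ _))// lerD// normrM ger0_norm// ler_wpM2l//.
- by move=> z /sqn_box zM; rewrite w4// mulr0.
Qed.

(** The integrand is the divergence of the field with components
    [G i z * w (|z|^2)]. *)
Lemma integral_div_sum0 (D : 'I_n -> nat) (G : 'I_n -> 'rV[R]_n -> R) w w' :
  (forall i, homog (D i) (G i)) -> C1c w w' ->
  lam.-integrable setT (EFin \o (fun z => (\sum_(i < n) partial i (G i) z) * w (sqn z)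
     + 2 * ((\sum_(i < n) z ord0 i * G i z) * w' (sqn z)))) /\
  \int[lam]_z ((\sum_(i < n) partial i (G i) z) * w (sqn z)
     + 2 * ((\sum_(i < n) z ord0 i * G i z) * w' (sqn z))) = 0.
Proof.
move=> hG hw; have cw := C1c_continuous hw; have [dw cw' w4 w'4] := hw.
rewrite (_ : (fun z => _) = (fun z => \sum_(i < n)
   (partial i (G i) z * w (sqn z) + 2 * (z ord0 i * G i z * w' (sqn z))))); last first.
  by apply/funext => z; rewrite big_split/= -mulr_sumr -!mulr_suml.
have [|h1 h2] := @Rintegral_sum _ (index_enum 'I_n)
  (fun i z => partial i (G i) z * w (sqn z) + 2 * (z ord0 i * G i z * w' (sqn z))).
  move=> i; exact: (integrableD measurableT
    (homog_cutoff_integrable (homog_partial i (hG i)) cw w4)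
    (integrableZl measurableT 2 (homog_cutoff_integrable (homog_X i (hG i)) cw' w'4))).
split=> //; rewrite h2 big1// => i _.
exact: integral_div0 (hG i) hw.
Qed.

Lemma div_grad d d' p q z : homog d p -> homog d' q ->
  \sum_(i < n) partial i (fun z => p z * partial i q z) z =
  p z * lap q z + \sum_(i < n) partial i p z * partial i q z.
Proof.
move=> hp hq; rewrite /lap mulr_sumr -big_split; apply: eq_bigr => i _ /=.
rewrite (partial_mul i hp (homog_partial i hq)).
by congr (_ + _); rewrite mulrC.
Qed.

Lemma radial_grad d q p z : homog d q ->
  \sum_(i < n) z ord0 i * (p z * partial i q z) = d%:R * (p z * q z).
Proof.
move=> hq; rewrite mulrCA -(homog_euler z hq) mulr_sumr.
by apply: eq_bigr => i _; rewrite mulrCA.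
Qed.

(** Strong induction on the degree [d] of [p]. As [Q] is harmonic, the fields
    [w Q grad p] and [w p grad Q] have divergences that differ by
    [w Q lap p + 2 (d - k) w' Q p]. Since [lap p] has lower degree, the
    induction hypothesis leaves [int w' Q p = 0] for all weights [w], because
    [d < k]. With the weight [s w(s)] this reads [int (s w' + w) Q p = 0].
    On the other hand the divergence of [w Q p z] is
    [((n + k + d) w + 2 s w') Q p], so [(n + k + d - 2) int w Q p = 0]. *)
Theorem harmonic_orthogonal k Q : (2 < n + k)%N -> homog k Q -> (forall z, lap Q z = 0) ->
  forall d p w w', (d < k)%N -> homog d p -> C1c w w' ->
  \int[lam]_z (Q z * p z * w (sqn z)) = 0.
Proof.
move=> nk hQ lQ d; elim/ltn_ind: d => d ih p w w' dk hp hw.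
have lapp0 v v' : C1c v v' -> \int[lam]_z (Q z * lap p z * v (sqn z)) = 0.
  move=> hv; case: d ih dk hp => [|[|d]] ih dk hp.
  - under eq_Rintegral.
      move=> z _; rewrite /lap big1 => [|i _]; last first.
        by rewrite (partial_homog0 i hp) partial_cst.
      rewrite mulr0 mul0r; over.
    by rewrite /Rintegral integral0.
  - under eq_Rintegral.
      move=> z _; rewrite /lap big1 => [|i _]; last first.
        by rewrite (partial_homog0 i (homog_partial i hp)).
      rewrite mulr0 mul0r; over.
    by rewrite /Rintegral integral0.
  - apply: ih (homog_lap hp) hv => //=.
    by rewrite (leq_trans _ dk)// ltnS -addn2 leq_addr.
have A v v' : C1c v v' -> \int[lam]_z (Q z * p z * v' (sqn z)) = 0.
  move=> hv; have cv := C1c_continuous hv; have [dv cv' v4 v'4] := hv.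
  have [i1 e1] := integral_div_sum0 (fun i => homogM hQ (homog_partial i hp)) hv.
  have [i2 e2] := integral_div_sum0 (fun i => homogM hp (homog_partial i hQ)) hv.
  have i3 := homog_cutoff_integrable (homogM hQ hp) cv' v'4.
  have i4 := homog_cutoff_integrable (homogM hQ (homog_lap hp)) cv v4.
  have : \int[lam]_z (Q z * lap p z * v (sqn z) +
      2 * (d%:R - k%:R) * (Q z * p z * v' (sqn z))) = 0.
    have := RintegralB measurableT i1 i2; rewrite e1 e2 subrr => <-.
    apply: eq_Rintegral => z _.
    have gen (A B C D g g' l q p' a b x y : R) : A = q * l + g -> B = x * (q * p') ->
        C = p' * 0 + g' -> D = y * (p' * q) -> g = g' ->
        q * l * a + 2 * (x - y) * (q * p' * b) =
        A * a + 2 * (B * b) - (C * a + 2 * (D * b)).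
      by move=> -> -> -> -> ->; ring.
    apply: gen; [exact: div_grad hQ hp|exact: radial_grad hp| |exact: radial_grad hQ|].
      have := div_grad z hp hQ; rewrite lQ; exact.
    by apply: eq_bigr => i _; rewrite mulrC.
  rewrite RintegralD//; last exact: (integrableZl measurableT (2 * (d%:R - k%:R)) i3).
  rewrite (lapp0 _ _ hv) add0r RintegralZl// => /eqP.
  rewrite mulf_eq0 => /orP[|/eqP//].
  by rewrite mulf_eq0 pnatr_eq0/= subr_eq0 eqr_nat ltn_eqF.
have cw := C1c_continuous hw; have [dw cw' w4 w'4] := hw.
have B := A _ _ (C1c_X hw).
have [i1 e1] := integral_div_sum0 (fun i => homog_X i (homogM hQ hp)) hw.
have i3 := homog_cutoff_integrable (homogM hQ hp) cw w4.
have [_ cx' x4 x'4] := C1c_X hw.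
have i4 := homog_cutoff_integrable (homogM hQ hp) cx' x'4.
have : \int[lam]_z ((n%:R + (k + d)%:R - 2) * (Q z * p z * w (sqn z))
    + 2 * (Q z * p z * (sqn z * w' (sqn z) + w (sqn z)))) = 0.
  rewrite -[RHS]e1; apply: eq_Rintegral => z _.
  have -> : \sum_(i < n) partial i (fun z => z ord0 i * (Q z * p z)) z =
      (n%:R + (k + d)%:R) * (Q z * p z).
    rewrite mulrDl -(homog_euler z (homogM hQ hp)) mulr_natl.
    rewrite (_ : Q z * p z *+ n = \sum_(i < n) Q z * p z); last by rewrite sumr_const card_ord.
    rewrite -big_split; apply: eq_bigr => i _ /=.
    by rewrite (partial_X i i (homogM hQ hp)) eqxx addrC mulr1.
  have -> : \sum_(i < n) z ord0 i * (z ord0 i * (Q z * p z)) = sqn z * (Q z * p z).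
    by rewrite /sqn mulr_suml; apply: eq_bigr => i _; rewrite mulrA -expr2.
  move: (sqn z) (Q z) (p z) (n%:R) ((k + d)%:R) => s q p' x y.
  by move: (w s) (w' s) => a b; ring.
rewrite RintegralD//; last 2 first.
- exact: (integrableZl measurableT _ i3).
- exact: (integrableZl measurableT 2 i4).
rewrite !RintegralZl// B mulr0 addr0 => /eqP.
rewrite mulf_eq0 => /orP[|/eqP//].
rewrite subr_eq0 -natrD eqr_nat addnA gtn_eqF//.
by rewrite (leq_trans nk)// leq_addr.
Qed.

End orthogonality.

(** * Integration along rays *)

Section polar.
Context {R : realType}.
Local Notation mu := (@lebesgue_measure R).

Lemma measurable_invr : measurable_fun setT (@GRing.inv R).
Proof.
have E : [set: R] = [set 0] `|` ~` [set 0] by rewrite setUv.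
rewrite E; apply/measurable_funU => //; first exact: measurableC.
split; first exact: measurable_fun_set1.
apply: open_continuous_measurable_fun; first by apply: closed_openC; exact: closed_eq.
by move=> x; rewrite inE/= => /eqP x0; exact: inv_continuous.
Qed.

(** The indicator of the positive half-line, which turns integrals over it
    into integrals over the line. *)
Definition posind (t : R) : R := \1_(`]0, +oo[%classic : set R) t.

Lemma posind_gt0 t : 0 < t -> posind t = 1.
Proof. by move=> t0; rewrite /posind indicE mem_set//= in_itv/= t0. Qed.

Lemma posind_le0 t : t <= 0 -> posind t = 0.
Proof.
by move=> t0; rewrite /posind indicE memNset//= in_itv/= andbT; apply/negP; rewrite -leNgt.
Qed.

Lemma measurable_posind : measurable_fun setT posind.
Proof. exact: measurable_indic. Qed.

Lemma measurable_scale n :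
  measurable_fun setT (fun zt : 'rV[R]_n * measurableTypeR R => zt.2 *: zt.1).
Proof.
apply: measurable_fun_rV => i.
rewrite (_ : (fun _ => _) =
  (fun zt : 'rV[R]_n * measurableTypeR R => zt.2 * zt.1 ord0 i)); last first.
  by apply/funext => y; rewrite !mxE.
apply: measurable_funM; first exact: measurable_snd.
exact: (measurableT_comp (measurable_coord_rV i) measurable_fst).
Qed.

Lemma measurable_enorm n : measurable_fun setT (@enorm R n).
Proof. exact: continuous_measurable_rV (@enorm_continuous R n). Qed.

Local Open Scope ereal_scope.

Section polar_weight.
Variables (n : nat) (om : R -> R).
Hypotheses (mom : measurable_fun setT om) (om0 : forall r, (0 <= om r)%R).
Local Notation lam := (@lebesgue_rV R n).

(** With [s = 1 / t] this is [int_0^oo om(s) ds / s]. *)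
Definition polar_cst : \bar R := \int[mu]_t (posind t * t^-1 * om t^-1)%:E.

Let H (F : 'rV[R]_n -> \bar R) (zt : 'rV[R]_n * measurableTypeR R) : \bar R :=
  (om (enorm zt.1) * (posind zt.2 * zt.2 ^+ n.-1))%:E * F (zt.2 *: zt.1)%R.

Let mH F : measurable_fun setT F -> measurable_fun setT (H F).
Proof.
move=> mF; apply: emeasurable_funM.
  apply/measurable_EFinP; apply: measurable_funM.
    apply: (measurableT_comp mom).
    exact: (measurableT_comp (@measurable_enorm n) measurable_fst).
  apply: measurable_funM; first exact: (measurableT_comp measurable_posind measurable_snd).
  exact: measurable_funX measurable_snd.
exact: (measurableT_comp mF (@measurable_scale n)).
Qed.

Let posind_ge0 t : (0 <= posind t)%R.
Proof. by rewrite /posind indicE. Qed.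

Let H0 F : (forall z, 0 <= F z) -> forall zt, 0 <= H F zt.
Proof.
move=> F0 zt; have [t0|t0] := leP zt.2 0%R.
  by rewrite /H posind_le0// mul0r mulr0 mul0e.
rewrite mule_ge0// lee_fin mulr_ge0// mulr_ge0// exprn_ge0//; exact: ltW.
Qed.

Lemma measurable_polar_inner (F : 'rV[R]_n -> \bar R) :
  measurable_fun setT F -> (forall z, 0 <= F z) ->
  measurable_fun setT (fun z => \int[mu]_t
    ((om (enorm z) * (posind t * t ^+ n.-1))%:E * F (t *: z)%R)).
Proof.
move=> mF F0.
exact: (@measurable_fun_fubini_tonelli_F _ _ _ _ R mu (H F) (mH mF) (H0 F0)).
Qed.

(** Exchange the integrals, substitute [y = t z] in the inner one, and exchange
    them back: the value [F y] gets the weight [int_0^oo om (|y| / t) dt / t],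
    which is independent of [y != 0] by the substitution [t = |y| s]. *)
Lemma polar_tonelli (F : 'rV[R]_n -> \bar R) : (0 < n)%N ->
  measurable_fun setT F -> (forall z, 0 <= F z) -> F 0%R = 0 ->
  \int[lam]_z \int[mu]_t ((om (enorm z) * (posind t * t ^+ n.-1))%:E * F (t *: z)%R)
  = polar_cst * \int[lam]_y F y.
Proof.
move=> n0 mF F0 F00.
rewrite (@fubini_tonelli _ _ _ _ R lam mu (H F) (mH mF) (H0 F0)).
pose H2 (yt : 'rV[R]_n * measurableTypeR R) : \bar R :=
  (posind yt.2 * yt.2^-1 * om (yt.2^-1 * enorm yt.1)%R)%:E * F yt.1.
have mH2 : measurable_fun setT H2.
  apply: emeasurable_funM; last exact: (measurableT_comp mF measurable_fst).
  apply/measurable_EFinP; apply: measurable_funM.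
    apply: measurable_funM; first exact: (measurableT_comp measurable_posind measurable_snd).
    exact: (measurableT_comp measurable_invr measurable_snd).
  apply: (measurableT_comp mom); apply: measurable_funM.
    exact: (measurableT_comp measurable_invr measurable_snd).
  exact: (measurableT_comp (@measurable_enorm n) measurable_fst).
have H20 yt : 0 <= H2 yt.
  rewrite mule_ge0// lee_fin mulr_ge0//; have [t0|t0] := leP yt.2 0%R.
    by rewrite posind_le0// mul0r.
  by rewrite mulr_ge0// invr_ge0 ltW.
transitivity (\int[mu]_t \int[lam]_y H2 (y, t)).
  apply: eq_integral => t _; have [t0|t0] := leP t 0%R.
    rewrite !integral0_eq// => z _; rewrite /H2 ?/H/= posind_le0//.
      by rewrite !mul0r mul0e.
    by rewrite mul0r mulr0 mul0e.
  rewrite /H2 /H /=; under eq_integral do rewrite posind_gt0// mul1r.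
  under [RHS]eq_integral do rewrite posind_gt0// mul1r.
  pose G y : \bar R := (om (t^-1 * enorm y)%R * t ^+ n.-1)%:E * F y.
  have mG : measurable_fun setT G.
    apply: emeasurable_funM => //; apply/measurable_EFinP; apply: measurable_funM => //.
    apply: (measurableT_comp mom); apply: measurable_funM => //; exact: measurable_enorm.
  have G0 y : 0 <= G y by rewrite mule_ge0// lee_fin mulr_ge0// exprn_ge0// ltW.
  have := @ge0_integral_affine R n G t 0%R (negbT (gt_eqF t0)) mG G0.
  rewrite -ge0_integralZl// ?lee_fin ?invr_ge0 ?exprn_ge0// => E.
  transitivity (\int[lam]_y G (t *: y + 0)%R).
    apply: eq_integral => z _; rewrite /G addr0 enormZ gtr0_norm// mulrA.
    by rewrite mulVf ?mul1r ?gt_eqF.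
  rewrite E; apply: eq_integral => y _; rewrite /G muleA -EFinM; congr (_%:E * _).
  rewrite gtr0_norm// mulrCA mulrC; congr (_ * _)%R.
  by rewrite -{1}(prednK n0) exprS invfM mulfVK// expf_neq0// gt_eqF.
rewrite -(@fubini_tonelli _ _ _ _ R lam mu H2 mH2 H20).
have mg : measurable_fun setT (fun t : R => (posind t * t^-1 * om t^-1)%:E).
  apply/measurable_EFinP; apply: measurable_funM.
    by apply: measurable_funM; [exact: measurable_posind|exact: measurable_invr].
  exact: (measurableT_comp mom measurable_invr).
have g0 (t : R) : 0 <= (posind t * t^-1 * om t^-1)%:E.
  rewrite lee_fin mulr_ge0//; have [t0|t0] := leP t 0%R.
    by rewrite posind_le0// mul0r.
  by rewrite mulr_ge0// invr_ge0 ltW.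
have c0 : 0 <= polar_cst by exact: integral_ge0.
rewrite -ge0_integralZl//.
apply: eq_integral => y _; have [->|y0] := eqVneq y 0%R.
  by rewrite F00 mule0 integral0_eq// => t _; rewrite /H2/= F00 mule0.
rewrite /H2/= ge0_integralZr//; last 2 first.
- apply/measurable_EFinP; apply: measurable_funM.
    by apply: measurable_funM; [exact: measurable_posind|exact: measurable_invr].
  apply: (measurableT_comp mom); apply: measurable_funM => //; exact: measurable_invr.
- move=> t _; rewrite lee_fin mulr_ge0//; have [t0|t0] := leP t 0%R.
    by rewrite posind_le0// mul0r.
  by rewrite mulr_ge0// invr_ge0 ltW.
congr (_ * _).
have r0 : (0 < enorm y)%R by rewrite enorm_gt0.
have ri : ((enorm y)^-1 != 0)%R by rewrite invr_eq0 gt_eqF.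
have ma : measurable_fun setT (fun t : R => (enorm y)^-1 * t + 0)%R.
  by apply: measurable_funD => //; exact: measurable_funM.
have := ge0_integral_affine1 0%R ri mg g0.
rewrite normfV gtr0_norm// invrK => E.
rewrite (_ : polar_cst = (enorm y)^-1%:E * ((enorm y)%:E * polar_cst)); last first.
  by rewrite muleA -EFinM mulVf ?gt_eqF// mul1e.
rewrite -E -ge0_integralZl//; 
  [|exact: (measurableT_comp mg ma)|by rewrite lee_fin invr_ge0 ltW].
apply: eq_integral => t _; rewrite addr0 -EFinM; congr EFin.
have [t0|t0] := leP t 0%R.
  by rewrite !posind_le0 ?mul0r ?mulr0// mulr_ge0_le0// invr_ge0 ltW.
rewrite !posind_gt0 ?mulr_gt0 ?invr_gt0// !mul1r invfM invrK (mulrC (enorm y) _).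
move: (om _) => o; field.
by rewrite !gt_eqF.
Qed.

End polar_weight.
End polar.

(** * A radial weight supported in an annulus *)

Section cutoff.
Context {R : realType}.
Implicit Types (s t u : R).
Local Notation mu := (@lebesgue_measure R).

(** The square of the positive part is of class C^1. *)
Definition posq u : R := Num.max 0 u ^+ 2.

Lemma max0_continuous : continuous (fun u : R => Num.max 0 u).
Proof. by move=> u; apply: continuous_max; [exact: cvg_cst|exact: cvg_id]. Qed.

Lemma is_derive_posq u : is_derive u (1 : R) posq (2 * Num.max 0 u).
Proof.
have [u0|u0|->] := ltgtP u 0.
- rewrite mulr0.
  apply: (@near_eq_is_derive _ _ _ (fun=> 0)).
  by near=> y; rewrite /posq max_l ?expr0n//; apply: ltW; near: y; exact: lt_nbhsl.
- have h2 : is_derive u (1 : R) (fun y : R => y * y) (2 * u).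
    apply: is_derive_eq (is_deriveM (is_derive_id u 1) (is_derive_id u 1)) _.
    by rewrite /GRing.scale/=; ring.
  apply: (@near_eq_is_derive _ _ _ _ _ _ _ _ _ h2).
  by near=> y; rewrite /posq max_r ?expr2//; apply: ltW; near: y; exact: lt_nbhsr.
- apply/is_derive1_caratheodory; exists (fun y => Num.max 0 y); split.
  + move=> y; rewrite /posq maxxx expr0n subr0 subr0 expr2.
    by case: (leP 0 y) => y0; rewrite ?mul0r.
  + exact: max0_continuous.
  + by rewrite maxxx mulr0.
Unshelve. all: by end_near. Qed.

(** Positive for [1 < s < 4] only: as a function of [s = |z|^2] it is
    supported in the annulus [1 <= |z| <= 2]. *)
Definition cutoff s : R := posq ((s - 1) * (4 - s)).
Definition cutoff' s : R := 2 * Num.max 0 ((s - 1) * (4 - s)) * (5 - 2 * s).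

Lemma cutoff_ge0 s : 0 <= cutoff s.
Proof. exact: sqr_ge0. Qed.

Lemma cutoff_out s : s <= 1 \/ 4 <= s -> cutoff s = 0.
Proof. by move=> h; rewrite /cutoff /posq max_l ?expr0n//; nra. Qed.

Lemma C1c_cutoff : C1c cutoff cutoff'.
Proof.
have dp s : is_derive s (1 : R) (fun s => (s - 1) * (4 - s)) (5 - 2 * s).
  have h1 : is_derive s (1 : R) (fun s => s - 1) (1 - 0).
    exact: (is_deriveB (is_derive_id s 1) (is_derive_cst (1 : R) s 1)).
  have h2 : is_derive s (1 : R) (fun s => 4 - s) (0 - 1).
    exact: (is_deriveB (is_derive_cst (4 : R) s 1) (is_derive_id s 1)).
  apply: is_derive_eq (is_deriveM h1 h2) _.
  by rewrite /GRing.scale/=; ring.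
split.
- by move=> s; exact: (is_derive1_comp (is_derive_posq _) (dp s)).
- have cp : continuous (fun s : R => (s - 1) * (4 - s)).
    by move=> s; apply/differentiable_continuous/derivable1_diffP; exact: (dp s).(ex_derive).
  move=> s; apply: (@continuousM _ _
    (fun s : R => 2 * Num.max 0 ((s - 1) * (4 - s))) (fun s : R => 5 - 2 * s)).
    apply: continuousM; first exact: cvg_cst.
    apply: (@continuous_comp _ _ _ (fun s : R => (s - 1) * (4 - s)) (fun u : R => Num.max 0 u)).
      exact: cp.
    exact: max0_continuous.
  apply: continuousB; first exact: cvg_cst.
  by apply: continuousM; [exact: cvg_cst|exact: cvg_id].
- by move=> s s4; apply: cutoff_out; right.
- by move=> s s4; rewrite /cutoff' max_l ?mulr0 ?mul0r//; nra.
Qed.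

(** The weight to be used along rays. The factor [|r|^N] cancels the
    denominator of a kernel [Q p / |z|^N], which leaves the polynomial [Q p]
    times the C^1 function [cutoff (|z|^2)]. *)
Definition radial (N : nat) (r : R) : R := cutoff (r ^+ 2) * `|r| ^+ N.

Lemma cutoff_continuous : continuous cutoff.
Proof. exact: C1c_continuous C1c_cutoff. Qed.

Lemma radial_continuous N : continuous (radial N).
Proof.
move=> r; apply: (@continuousM _ _ (fun r : R => cutoff (r ^+ 2)) (fun r : R => `|r| ^+ N)).
  by apply: (@continuous_comp _ _ _ (fun r : R => r ^+ 2) cutoff);
    [exact: exprn_continuous|exact: cutoff_continuous].
by apply: (@continuous_comp _ _ _ (fun r : R => `|r|) (fun r : R => r ^+ N));
  [exact: norm_continuous|exact: exprn_continuous].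
Qed.

Lemma cutoff_le9 s : cutoff s <= 9.
Proof.
rewrite /cutoff /posq.
have h : (s - 1) * (4 - s) <= 9 / 4 by have := sqr_ge0 (s - 5 / 2); rewrite expr2; lra.
move: ((s - 1) * (4 - s)) h => u h; rewrite expr2.
by case: (leP 0 u) => u0; nra.
Qed.

Lemma radial_inv0 N t : 0 < t -> (t < 2^-1) || (1 < t) -> radial N t^-1 = 0.
Proof.
move=> t0 h; rewrite /radial cutoff_out ?mul0r//.
have ti : 0 < t^-1 by rewrite invr_gt0.
have tt : t * t^-1 = 1 by rewrite mulfV ?gt_eqF.
by case/orP: h => h; [right|left]; rewrite expr2; nra.
Qed.

Lemma measurable_radial N : measurable_fun setT (radial N).
Proof. exact: continuous_measurable_fun (@radial_continuous N). Qed.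

Lemma radial_ge0 N r : 0 <= radial N r.
Proof. by rewrite mulr_ge0 ?cutoff_ge0// exprn_ge0. Qed.

Lemma polar_integrand_ge0 N t : 0 <= posind t * t^-1 * radial N t^-1.
Proof.
have [t0|t0] := leP t 0; first by rewrite posind_le0// !mul0r.
have ti : 0 <= t^-1 by rewrite invr_ge0 ltW.
by rewrite posind_gt0// mul1r mulr_ge0// radial_ge0.
Qed.

Local Open Scope ereal_scope.

Lemma measurable_polar_integrand N : measurable_fun setT
  (fun t : R => (posind t * t^-1 * radial N t^-1)%R%:E).
Proof.
apply/measurable_EFinP; apply: measurable_funM.
  by apply: measurable_funM; [exact: measurable_posind|exact: measurable_invr].
exact: (measurableT_comp (measurable_radial N) measurable_invr).
Qed.

Lemma polar_cst_fin N : polar_cst (radial N) < +oo.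
Proof.
pose C : R := (2 * (9 * 2 ^+ N))%R.
have C0 : (0 <= C)%R by rewrite !mulr_ge0// exprn_ge0.
apply: (@le_lt_trans _ _ (\int[mu]_t (C%:E * (\1_(`[2^-1, 1]%classic : set R) t)%:E))).
  apply: ge0_le_integral => //.
  - by move=> t _; rewrite lee_fin polar_integrand_ge0.
  - exact: measurable_polar_integrand.
  - by apply/measurable_EFinP; apply: measurable_funM.
  - move=> t _; rewrite -EFinM lee_fin indicE.
    have [t0|t0] := leP t 0%R.
      by rewrite posind_le0// !mul0r mulr_ge0.
    rewrite posind_gt0// mul1r; case: (boolP ((t < 2^-1) || (1 < t))%R) => h.
      by rewrite radial_inv0// mulr0 mulr_ge0.
    move: h; rewrite negb_or -!leNgt => /andP[t1 t2].
    rewrite mem_set ?mulr1; last by rewrite /= in_itv/= t1 t2.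
    have ti : (t^-1 <= 2)%R by rewrite invf_ple ?posrE.
    have ti0 : (0 <= t^-1)%R by rewrite invr_ge0 ltW.
    apply: ler_pM => //; first exact: radial_ge0.
    rewrite /radial ger0_norm//.
    apply: ler_pM; [exact: cutoff_ge0|exact: exprn_ge0|exact: cutoff_le9|].
    by rewrite lerXn2r ?nnegrE.
rewrite ge0_integralZl//; last first.
  by apply/measurable_EFinP.
rewrite integral_indic//= setIT lebesgue_measure_itv/=.
by case: ifP => _; rewrite ?mule0 ?ltry// -EFinB -EFinM ltry.
Qed.

Lemma polar_cst_gt0 N : 0 < polar_cst (radial N).
Proof.
apply: (@lt_le_trans _ _ (\int[mu]_t ((\1_(`[5 / 8, 3 / 4]%classic : set R) t)%:E))).
  rewrite integral_indic//= setIT lebesgue_measure_itv/= lte_fin ifT; last by lra.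
  by rewrite -EFinB lte_fin; lra.
apply: ge0_le_integral => //.
- exact/measurable_EFinP.
- exact: measurable_polar_integrand.
- move=> t _; rewrite lee_fin indicE.
  have [t0|t0] := leP t 0%R.
    by rewrite posind_le0// !mul0r memNset// => /=; rewrite in_itv/= => /andP[]; lra.
  case: (boolP (t \in _)) => [|_]; last exact: polar_integrand_ge0.
    rewrite posind_gt0// mul1r inE/= in_itv/= => /andP[t1 t2].
    have tt : (t * t^-1 = 1)%R by rewrite mulfV ?gt_eqF.
    have ti1 : (1 <= t^-1)%R by rewrite invf_ge1//; lra.
    (* for 5/8 <= t <= 3/4 the point t^-2 lies well inside ]1, 4[, where
       cutoff is at least 1 *)
    have h1 : (4 / 3 <= t^-1)%R by nra.
    have h2 : (t^-1 <= 8 / 5)%R by nra.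
    have tN : (1 <= t^-1 ^+ N)%R by exact: exprn_ege1.
    have b1 : (1 <= cutoff (t^-1 ^+ 2))%R.
      rewrite /cutoff /posq; set v := (t^-1)%R in ti1 h1 h2 *.
      have h3 : (16 / 9 <= v ^+ 2)%R by rewrite expr2; nra.
      have h4 : (v ^+ 2 <= 64 / 25)%R by rewrite expr2; nra.
      move: (v ^+ 2)%R h3 h4 => w h3 h4.
      have hw : (1 <= (w - 1) * (4 - w))%R.
        have : (0 <= (w - 16 / 9) * (64 / 25 - w))%R by rewrite mulr_ge0// subr_ge0.
        by nra.
      by rewrite max_r ?exprn_ege1// (le_trans _ hw).
    apply: (@le_trans _ _ (1 * (1 * 1))%R); first by rewrite !mulr1.
    rewrite /radial ger0_norm ?(le_trans ler01)//.
    by apply: ler_pM => //; apply: ler_pM.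
Qed.

End cutoff.

(** * Averaging a homogeneous kernel along rays *)

Section average.
Context {R : realType} {n : nat}.
Local Notation mu := (@lebesgue_measure R).
Local Notation lam := (@lebesgue_rV R n).
Variables (n0 : (0 < n)%N) (j N : nat) (Om : set 'rV[R]_n).
Hypothesis mOm : measurable Om.

(** [j] counts the powers beyond the critical homogeneity [- n]. *)
Definition homogneg (K : 'rV[R]_n -> R) := [/\ measurable_fun setT K, K 0 = 0 &
  forall (t : R) z, 0 < t -> K (t *: z) = K z * (t ^+ (n + j))^-1].

Let ray z t : R := posind t * (t ^+ j.+1)^-1 * \1_Om (t *: z).

Local Open Scope ereal_scope.

Let mray z : measurable_fun setT (ray z).
Proof.
apply: measurable_funM.
  apply: measurable_funM; first exact: measurable_posind.
  exact: (measurableT_comp measurable_invr (@exprn_measurable R setT j.+1)).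
have ms : measurable_fun setT (fun t : measurableTypeR R => t *: z).
  exact: (measurableT_comp (@measurable_scale R n) (measurable_pair1 z)).
exact: (measurableT_comp (measurable_indic mOm) ms).
Qed.

Let ray_ge0 z t : (0 <= ray z t)%R.
Proof.
rewrite /ray mulr_ge0//; have [t0|t0] := leP t 0%R.
  by rewrite posind_le0// mul0r.
by rewrite posind_gt0// mul1r invr_ge0 exprn_ge0// ltW.
Qed.

(** On the ray through [z] one has [K (t z) t^(n - 1) = K z t^(-j - 1)], so the
    inner integral in [polar_tonelli] is [K z] times the mass of the part of
    the ray that lies in [Om]. *)
Lemma ge0_average (K : 'rV[R]_n -> R) : homogneg K -> (forall z, (0 <= K z)%R) ->
  measurable_fun setT (fun z => (radial N (enorm z) * K z)%:E * \int[mu]_t (ray z t)%:E) /\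
  \int[lam]_z ((radial N (enorm z) * K z)%:E * \int[mu]_t (ray z t)%:E) =
  polar_cst (radial N) * \int[lam]_y (K y * \1_Om y)%:E.
Proof.
move=> [mK K00 hK] K0.
pose F y : \bar R := (K y * \1_Om y)%:E.
have mF : measurable_fun setT F.
  by apply/measurable_EFinP; apply: measurable_funM.
have F0 y : 0 <= F y by rewrite lee_fin mulr_ge0.
have F00 : F 0%R = 0 by rewrite /F K00 mul0r.
have E z : (radial N (enorm z) * K z)%:E * \int[mu]_t (ray z t)%:E =
    \int[mu]_t ((radial N (enorm z) * (posind t * t ^+ n.-1))%:E * F (t *: z)%R).
  rewrite -ge0_integralZl//; last 3 first.
  - by apply/measurable_EFinP; exact: mray.
  - by move=> t _; rewrite lee_fin.
  - by rewrite lee_fin mulr_ge0// radial_ge0.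
  apply: eq_integral => t _; rewrite /F /ray -!EFinM; congr EFin.
  have [t0|t0] := leP t 0%R; first by rewrite posind_le0// !(mul0r, mulr0).
  rewrite posind_gt0// !mul1r hK//.
  have -> : (n + j = n.-1 + j.+1)%N by rewrite -{1}(prednK n0) addSnnS.
  rewrite exprD invfM.
  have tn : (t ^+ n.-1 != 0)%R by rewrite expf_neq0// gt_eqF.
  move: (radial _ _) (K z) (\1_Om _) => a b c.
  move: (t ^+ n.-1)%R tn (t ^+ j.+1)^-1%R => d d0 e.
  by field.
have -> : (fun z => (radial N (enorm z) * K z)%:E * \int[mu]_t (ray z t)%:E) =
    (fun z => \int[mu]_t ((radial N (enorm z) * (posind t * t ^+ n.-1))%:E * F (t *: z)%R)).
  exact/funext.
split.
  apply: measurable_polar_inner => //; first exact: measurable_radial.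
  exact: radial_ge0.
apply: polar_tonelli => //; first exact: measurable_radial.
exact: radial_ge0.
Qed.

(** Signed kernels follow by splitting [K] into its positive and negative
    parts, both of which are homogeneous. *)
Lemma average (K q : 'rV[R]_n -> R) : homogneg K ->
  lam.-integrable setT (EFin \o (fun z => K z * \1_Om z)%R) ->
  (forall z, z != 0%R -> \int[mu]_t (ray z t)%:E = (q z)%:E) ->
  lam.-integrable setT (EFin \o (fun z => radial N (enorm z) * K z * q z)%R) /\
  (\int[lam]_z (radial N (enorm z) * K z * q z) =
    fine (polar_cst (radial N)) * \int[lam]_y (K y * \1_Om y))%R.
Proof.
move=> [mK K00 hK] iK hq.
pose Kp z := Num.max 0%R (K z); pose Kn z := Num.max 0%R (- K z)%R.
have KE z : (K z = Kp z - Kn z)%R.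
  rewrite /Kp /Kn; have [h|h] := leP 0%R (K z).
    by rewrite max_l ?subr0// oppr_le0.
  by rewrite max_r ?sub0r ?opprK// oppr_ge0 ltW.
have Kp0 z : (0 <= Kp z)%R by rewrite le_max lexx.
have Kn0 z : (0 <= Kn z)%R by rewrite le_max lexx.
have hp : homogneg Kp.
  split; [exact: measurable_maxr|by rewrite /Kp K00 maxxx|].
  move=> t z t0; rewrite /Kp hK// -{1}(mul0r (t ^+ (n + j))^-1%R) maxr_pMl//.
  by rewrite invr_ge0 exprn_ge0// ltW.
have hn : homogneg Kn.
  split; last 2 first.
  - by rewrite /Kn K00 oppr0 maxxx.
  - move=> t z t0; rewrite /Kn hK// -mulNr -{1}(mul0r (t ^+ (n + j))^-1%R) maxr_pMl//.
    by rewrite invr_ge0 exprn_ge0// ltW.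
  apply: measurable_maxr => //.
  exact: (measurableT_comp (@oppr_measurable R setT) mK).
have KpK z : (`|Kp z| <= `|K z|)%R.
  by rewrite ger0_norm// /Kp ge_max normr_ge0 ler_norm.
have KnK z : (`|Kn z| <= `|K z|)%R.
  by rewrite ger0_norm// /Kn ge_max normr_ge0 -normrN ler_norm.
have cfin : polar_cst (radial N) = (fine (polar_cst (radial N)))%:E :> \bar R.
  by rewrite fineK// ge0_fin_numE ?polar_cst_fin// ltW// polar_cst_gt0.
have main (L : 'rV[R]_n -> R) : homogneg L -> (forall z, (0 <= L z)%R) ->
    (forall z, (`|L z| <= `|K z|)%R) ->
    [/\ lam.-integrable setT (EFin \o (fun z => L z * \1_Om z)%R),
     lam.-integrable setT (EFin \o (fun z => radial N (enorm z) * L z * q z)%R) &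
    (\int[lam]_z (radial N (enorm z) * L z * q z) =
    fine (polar_cst (radial N)) * \int[lam]_y (L y * \1_Om y))%R].
  move=> hL L0 LK; have [mL L00 _] := hL.
  have iL : lam.-integrable setT (EFin \o (fun z => L z * \1_Om z)%R).
    apply: le_integrable iK => //.
      by apply/measurable_EFinP; apply: measurable_funM.
    by move=> z _; rewrite lee_fin !normrM ler_wpM2r.
  have [mA EA] := ge0_average hL L0.
  have E : (fun z => (radial N (enorm z) * L z)%:E * \int[mu]_t (ray z t)%:E) =
      (fun z => (radial N (enorm z) * L z * q z)%:E).
    apply/funext => z; have [->|z0] := eqVneq z 0%R; first by rewrite L00 mulr0 mul0r mul0e.
    by rewrite hq// -EFinM.
  have pos z : 0 <= (radial N (enorm z) * L z * q z)%:E.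
    have -> : (radial N (enorm z) * L z * q z)%:E =
        (radial N (enorm z) * L z)%:E * \int[mu]_t (ray z t)%:E.
      exact: (esym (congr1 (fun f => f z) E)).
    apply: mule_ge0; first by rewrite lee_fin mulr_ge0// radial_ge0.
    by apply: integral_ge0 => t _; rewrite lee_fin.
  rewrite E in mA EA.
  have EA' : \int[lam]_z (radial N (enorm z) * L z * q z)%:E =
      (fine (polar_cst (radial N)) * fine (\int[lam]_y (L y * \1_Om y)%:E))%:E.
    rewrite EFinM -cfin fineK//; exact: (integrable_fin_num measurableT iL).
  split=> //; last by rewrite /Rintegral EA'.
  apply/integrableP; split => //.
  rewrite (eq_integral (fun z => (radial N (enorm z) * L z * q z)%:E)) ?EA' ?ltry//.
  by move=> z _; rewrite gee0_abs//; exact: pos.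
have [ip1 ip2 ep] := main Kp hp Kp0 KpK.
have [in1 in2 en] := main Kn hn Kn0 KnK.
have Eq : (fun z => radial N (enorm z) * K z * q z)%R =
    (fun z => radial N (enorm z) * Kp z * q z -
      radial N (enorm z) * Kn z * q z)%R.
  by apply/funext => z; rewrite KE mulrBr mulrBl.
rewrite Eq; split; first exact: (integrableB measurableT ip2 in2).
rewrite RintegralB// ep en -mulrBr -RintegralB//; congr (_ * _)%R.
by apply: eq_Rintegral => z _; rewrite -mulrBl -KE.
Qed.

End average.

(** * Rays in a pierced ball *)

Section ray.
Context {R : realType}.
Local Notation mu := (@lebesgue_measure R).
Implicit Types (a b t : R).

Definition prim (j : nat) t : R := if j is 0 then ln t else - (t ^+ j)^-1 / j%:R.

Lemma is_derive_prim j t : 0 < t -> is_derive t (1 : R) (prim j) (t ^+ j.+1)^-1.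
Proof.
move=> t0; have tn : t != 0 by rewrite gt_eqF.
case: j => [|j]; first by rewrite expr1; exact: is_derive1_ln.
pose g (u : R) : R := u ^+ j.+1.
have dg : is_derive t (1 : R) g (j.+1%:R * t ^+ j).
  split; first exact: exprn_derivable.
  by rewrite (exp_derive j.+1 t 1) /GRing.scale/= mulr1.
have gt : g t != 0 by rewrite expf_neq0.
have dgv : derivable g t 1 by exact: dg.(ex_derive).
have h : is_derive t (1 : R) (fun u => (g u)^-1) (- (g t) ^- 2 * (j.+1%:R * t ^+ j)).
  split; first exact: (@derivableV _ _ g t 1 gt dgv).
  rewrite (_ : 'D_1 _ t = - (g t) ^- 2 *: 'D_1 g t); last exact: (@deriveV _ _ g t 1 gt dgv).
  by rewrite (dg.(derive_val)).
have h2 := is_deriveZ (- j.+1%:R^-1) h.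
have -> : prim j.+1 = (- j.+1%:R^-1) *: (fun u => (g u)^-1).
  apply/funext => u; transitivity (- j.+1%:R^-1 * (g u)^-1); last by [].
  by rewrite /prim /g !mulNr mulrC.
apply: is_derive_eq h2 _; rewrite /GRing.scale/= /g.
have jn : j.+1%:R != 0 :> R by rewrite pnatr_eq0.
have tj : t ^+ j != 0 by rewrite expf_neq0.
rewrite !exprS; move: (t ^+ j) tj (j.+1%:R : R) jn => u u0 c c0; field.
by rewrite c0 tn u0.
Qed.

Lemma ray_integral j a b : 0 < a -> a < b ->
  (\int[mu]_t (posind t * (t ^+ j.+1)^-1 * \1_(`[a, b[%classic : set R) t)%:E)%E =
  (prim j b - prim j a)%:E.
Proof.
move=> a0 ab.
have dF t : 0 < t -> derivable (prim j) t 1 by move=> /(is_derive_prim j)[].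
have cF t : 0 < t -> {for t, continuous (prim j)}.
  by move=> t0; apply/differentiable_continuous/derivable1_diffP; exact: dF.
pose f (t : R) : R := (t ^+ j.+1)^-1.
have cf t : 0 < t -> {for t, continuous f}.
  move=> t0; apply: continuousV; first by rewrite expf_neq0// gt_eqF.
  exact: exprn_continuous.
have := @continuous_FTC2 R f (prim j) a b ab.
rewrite EFinB => <-; last 3 first.
- apply: continuous_in_subspaceT => t; rewrite inE/= in_itv/= => /andP[at_ _].
  by apply: cf; exact: lt_le_trans at_.
- split.
  + by move=> t; rewrite in_itv/= => /andP[at_ _]; apply: dF; exact: lt_trans at_.
  + by apply: cvg_at_right_filter; exact: cF.
  + by apply: cvg_at_left_filter; apply: cF; exact: lt_trans ab.
- move=> t; rewrite in_itv/= => /andP[at_ _]; have t0 : 0 < t by exact: lt_trans at_.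
  by rewrite derive1E; have := is_derive_prim j t0 => -[_ ->].
rewrite -integral_itv_bndo_bndc; last first.
  apply/measurable_EFinP/measurable_funTS.
  exact: (measurableT_comp measurable_invr (@exprn_measurable R setT j.+1)).
rewrite [RHS]integral_mkcond; apply: eq_integral => t _.
rewrite patchE indicE /f; case: (boolP (t \in _)) => [|_]; last by rewrite mulr0.
rewrite inE/= in_itv/= => /andP[at_ _].
by rewrite posind_gt0 ?mul1r ?mulr1//; exact: lt_le_trans at_.
Qed.

End ray.

Section geometry.
Context {R : realType} {n : nat}.
Implicit Types (x z : 'rV[R]_n) (t : R).

Definition dot x z : R := \sum_(i < n) x ord0 i * z ord0 i.

Lemma homog_dot x : homog 1 (dot x).
Proof. by apply: homog_sum => i _; apply: homogZ; exact: homog_coord. Qed.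

Lemma dotN x z : dot x (- z) = - dot x z.
Proof. by rewrite (homogN _ (homog_dot x)) expr1 mulN1r. Qed.

Lemma sqnN z : sqn (- z) = sqn z.
Proof. by rewrite (homogN _ homog_sqn) expr2 mulrNN !mul1r. Qed.

Lemma sqn_line x z t : sqn (x - t *: z) = sqn x - 2 * t * dot x z + t ^+ 2 * sqn z.
Proof.
rewrite /sqn /dot !mulr_sumr -sumrB -big_split; apply: eq_bigr => i _ /=.
by rewrite !mxE; ring.
Qed.

Lemma cauchy_schwarz x z : dot x z ^+ 2 <= sqn x * sqn z.
Proof.
have [->|x0] := eqVneq x 0.
  rewrite /dot big1 ?expr0n ?mulr_ge0 ?sqn_ge0// => i _.
  by rewrite mxE mul0r.
have s0 : 0 < sqn x by rewrite sqn_gt0.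
have := sqn_ge0 (z - (dot x z / sqn x) *: x); rewrite sqn_line.
have -> : dot z x = dot x z by apply: eq_bigr => i _; rewrite mulrC.
move: (dot x z) (sqn x) (sqn z) s0 => d s u s0.
have -> : u - 2 * (d / s) * d + (d / s) ^+ 2 * s = (s * u - d ^+ 2) / s.
  by field; rewrite gt_eqF.
by rewrite pmulr_lge0 ?invr_gt0// subr_ge0.
Qed.

Lemma enorm_triangle x z : enorm (x - z) <= enorm x + enorm z.
Proof.
have h0 : 0 <= enorm x + enorm z by rewrite addr_ge0// enorm_ge0.
rewrite -(@ler_pXn2r _ 2)// ?nnegrE ?enorm_ge0//.
rewrite sqr_enorm -[z]scale1r sqn_line scale1r -!sqr_enorm.
have cs := cauchy_schwarz x z; rewrite -!sqr_enorm -exprMn in cs.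
have d0 : - dot x z <= enorm x * enorm z.
  apply: le_trans (ler_norm _) _; rewrite normrN.
  rewrite -(@ler_pXn2r _ 2)// ?nnegrE ?mulr_ge0 ?enorm_ge0//.
  by rewrite real_normK ?num_real.
move: (dot x z) (enorm x) (enorm z) d0 => d a b d0.
by rewrite sqrrD; lra.
Qed.

(** Here [z] stands for [x - y]: these are the [y] of the ball of radius [r]
    at distance at least [e] from [x]. *)
Definition pierced x (r e : R) : set 'rV[R]_n := [set z | e <= enorm z /\ enorm (x - z) < r].

Lemma measurable_pierced x r e : measurable (pierced x r e).
Proof.
have mx : measurable_fun setT (fun z => enorm (x - z)).
  have := measurableT_comp (@measurable_enorm R n) (measurable_affine_rV (-1) x).
  by under eq_fun do rewrite /= scaleN1r addrC.
have -> : pierced x r e = (@enorm R n @^-1` `[e, +oo[%classic) `&`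
   ((fun z => enorm (x - z)) @^-1` `]-oo, r[%classic).
  by apply/seteqP; split => z; rewrite /pierced/= !in_itv/= andbT.
apply: measurableI; rewrite -[X in measurable X]setTI; first exact: measurable_enorm.
exact: mx.
Qed.

Section exit.
Variables (x : 'rV[R]_n) (r : R).
Hypotheses (xr : enorm x < r).

Let D := r ^+ 2 - sqn x.
Let S z := Num.sqrt (dot x z ^+ 2 + sqn z * D).
(** The positive root [t] of [|x - t z| = r]; as [x] lies inside the ball, the
    two roots have opposite signs. *)
Definition exit_time z := (dot x z + S z) / sqn z.

Let D0 : 0 < D.
Proof.
by rewrite subr_gt0 -sqr_enorm ltrXn2r ?nnegrE ?enorm_ge0//.
Qed.

Let SS z : S z ^+ 2 = dot x z ^+ 2 + sqn z * D.
Proof. by rewrite sqr_sqrtr// addr_ge0 ?sqr_ge0// mulr_ge0 ?sqn_ge0// ltW. Qed.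

Let S_gt z : z != 0 -> `|dot x z| < S z.
Proof.
move=> z0; rewrite -(@ltr_pXn2r _ 2)// ?nnegrE ?sqrtr_ge0//.
by rewrite SS real_normK ?num_real// ltrDl mulr_gt0// sqn_gt0.
Qed.

Let SN z : S (- z) = S z.
Proof. by rewrite /S dotN sqnN sqrrN. Qed.

Lemma exit_time_gt0 z : z != 0 -> 0 < exit_time z.
Proof.
move=> z0; rewrite divr_gt0 ?sqn_gt0//.
by have := S_gt z0; rewrite ltr_norml => /andP[]; lra.
Qed.

Lemma before_exit z t : z != 0 -> 0 < t -> (enorm (x - t *: z) < r) = (t < exit_time z).
Proof.
move=> z0 t0; have s0 : 0 < sqn z by rewrite sqn_gt0.
have r0 : 0 <= r by exact: le_trans (enorm_ge0 x) (ltW xr).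
rewrite -(@ltr_pXn2r _ 2)// ?nnegrE ?enorm_ge0// sqr_enorm sqn_line.
rewrite ltr_pdivlMr//.
have := S_gt z0; rewrite ltr_norml => /andP[S1 S2]; have S3 := SS z.
rewrite /D in S3; have d0 := D0; rewrite /D in d0.
move: (dot x z) (sqn z) (S z) (sqn x) s0 S1 S2 S3 d0 => d s u v s0 S1 S2 S3 d0.
have E : s * (v - 2 * t * d + t ^+ 2 * s - r ^+ 2) = (t * s - d - u) * (t * s - d + u).
  transitivity ((t * s - d) ^+ 2 - u ^+ 2); last by ring.
  by rewrite S3; ring.
have p0 : 0 < t * s - d + u by have := mulr_gt0 t0 s0; lra.
rewrite -subr_lt0 -(pmulr_rlt0 _ s0) E pmulr_llt0//.
by rewrite -addrA -opprD subr_lt0.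
Qed.

Lemma exit_time_mul z : z != 0 -> exit_time z * exit_time (- z) = D / sqn z.
Proof.
move=> z0; have s0 : sqn z != 0 by rewrite sqn_eq0.
rewrite /exit_time SN dotN sqnN; have := SS z.
move: (dot x z) (S z) (sqn z) s0 => d u s s0 h.
have -> : (d + u) / s * ((- d + u) / s) = (u ^+ 2 - d ^+ 2) / s ^+ 2 by field.
by rewrite h; field.
Qed.

Lemma exit_time_inv z : z != 0 -> (exit_time z)^-1 = (S z - dot x z) / D.
Proof.
move=> z0; have s0 : sqn z != 0 by rewrite sqn_eq0.
have h0 : 0 < dot x z + S z by have := S_gt z0; rewrite ltr_norml => /andP[]; lra.
have := SS z; rewrite /exit_time.
have dn : D != 0 by rewrite gt_eqF// D0.
move: (dot x z) (S z) (sqn z) s0 h0 D dn => d u s s0 h0 c dn h.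
have n1 : d + u != 0 by rewrite gt_eqF.
rewrite invf_div; apply/eqP; rewrite eqr_div//; apply/eqP.
by rewrite (_ : (u - d) * (d + u) = u ^+ 2 - d ^+ 2); [rewrite h; ring|ring].
Qed.

End exit.

(** Newton's identities: the power sums of [u] and [v] obey a linear recurrence
    with coefficients [u + v] and [u v]. *)
Lemma homog_power_sum (u v A B : 'rV[R]_n -> R) : homog 1 A -> homog 2 B ->
  (forall z, u z + v z = A z) -> (forall z, u z * v z = B z) ->
  forall j, homog j (fun z => u z ^+ j + v z ^+ j).
Proof.
move=> hA hB uvA uvB.
suff H j : homog j (fun z => u z ^+ j + v z ^+ j) /\
    homog j.+1 (fun z => u z ^+ j.+1 + v z ^+ j.+1) by move=> j; exact: (H j).1.
elim: j => [|j [ih1 ih2]].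
  split.
    rewrite (_ : (fun _ => _) = fun=> 2); first exact: homog_cst.
    by apply/funext => z; rewrite !expr0.
  rewrite (_ : (fun _ => _) = A) //.
  by apply/funext => z; rewrite !expr1.
split=> //.
rewrite (_ : (fun _ => _) = fun z => A z * (u z ^+ j.+1 + v z ^+ j.+1) +
    (-1) * (B z * (u z ^+ j + v z ^+ j))).
  apply: homog_D; first by rewrite -add1n; exact: homogM.
  by apply: homogZ; rewrite -add2n; exact: homogM.
apply/funext => z; rewrite -uvA -uvB !exprS.
by move: (u z ^+ j) (v z ^+ j) => a b; ring.
Qed.

(** For [j > 0], [1 / exit_time z] and [- 1 / exit_time (- z)] are the values
    [(S - dot x z) / D] and [(- S - dot x z) / D], with sum and product
    polynomial in [z], so that their power sums are polynomials; the same holds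
    for [|z| / e] and [- |z| / e]. For [j = 0] the primitives are logarithms,
    and [exit_time z * exit_time (- z) = D / |z|^2] makes the symmetrized
    function constant. *)
Lemma symmetrized_ray x r e j : enorm x < r -> 0 < e ->
  exists2 P, homog j P & forall z, z != 0 ->
    (prim j (exit_time x r z) - prim j (e / enorm z)) +
    (-1) ^+ j * (prim j (exit_time x r (- z)) - prim j (e / enorm (- z))) = P z.
Proof.
move=> xr e0.
set D := r ^+ 2 - sqn x.
have D0 : 0 < D.
  by rewrite subr_gt0 -sqr_enorm ltrXn2r ?nnegrE ?enorm_ge0//.
case: j => [|j].
  exists (fun=> ln (D / e ^+ 2)); first exact: homog_cst.
  move=> z z0; have zN : - z != 0 by rewrite oppr_eq0.
  have r0 : 0 < enorm z by rewrite enorm_gt0.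
  have t1 := exit_time_gt0 xr z0; have t2 := exit_time_gt0 xr zN.
  have s0 : 0 < sqn z by rewrite sqn_gt0.
  rewrite /= expr0 mul1r enormN.
  have LN (a b c d : R) : 0 < a -> 0 < b -> 0 < c -> 0 < d ->
      (ln a - ln b) + (ln c - ln d) = ln ((a / b) * (c / d)).
    by move=> *; rewrite lnM ?posrE ?divr_gt0// !ln_div.
  have a0 : 0 < e / enorm z by rewrite divr_gt0.
  rewrite (LN _ _ _ _ t1 a0 t2 a0); congr ln.
  rewrite mulrACA exit_time_mul// -/D -sqr_enorm.
  move: (enorm z) r0 => rho r0; field.
  by rewrite !gt_eqF.
pose S z := Num.sqrt (dot x z ^+ 2 + sqn z * D).
have h1 : homog j.+1 (fun z => (S z - dot x z) ^+ j.+1 + (- S z - dot x z) ^+ j.+1).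
  apply: (@homog_power_sum _ _ (fun z => (-2) * dot x z) (fun z => (- D) * sqn z)).
  - by apply: homogZ; exact: homog_dot.
  - by apply: homogZ; exact: homog_sqn.
  - by move=> z; ring.
  - move=> z; have : S z ^+ 2 = dot x z ^+ 2 + sqn z * D.
      by rewrite sqr_sqrtr// addr_ge0 ?sqr_ge0// mulr_ge0 ?sqn_ge0// ltW.
    move: (S z) (dot x z) (sqn z) => u d s h.
    by rewrite (_ : (u - d) * _ = d ^+ 2 - u ^+ 2); [rewrite h; ring|ring].
have h2 : homog j.+1 (fun z => enorm z ^+ j.+1 + (- enorm z) ^+ j.+1).
  apply: (@homog_power_sum _ _ (fun z => 0) (fun z => (-1) * sqn z)).
  - exact: homog_0.
  - by apply: homogZ; exact: homog_sqn.
  - by move=> z; rewrite subrr.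
  - by move=> z; rewrite -sqr_enorm; ring.
exists (fun z => (j.+1%:R * e ^+ j.+1)^-1 * (enorm z ^+ j.+1 + (- enorm z) ^+ j.+1) +
   - (j.+1%:R * D ^+ j.+1)^-1 * ((S z - dot x z) ^+ j.+1 + (- S z - dot x z) ^+ j.+1)).
  by apply: homog_D; apply: homogZ.
move=> z z0; have zN : - z != 0 by rewrite oppr_eq0.
have rz : enorm z != 0 by rewrite enorm_eq0.
rewrite /prim -!exprVn !exit_time_inv// -/D -/(S z) -/(S (- z)).
have -> : S (- z) = S z by rewrite /S dotN sqnN sqrrN.
rewrite enormN dotN invf_div opprK.
rewrite -[- S z - dot x z]opprD -[- enorm z]mulN1r -[- (S z + dot x z)]mulN1r !exprMn !exprVn.
have jn : j.+1%:R != 0 :> R by rewrite pnatr_eq0.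
have en : e ^+ j.+1 != 0 by rewrite expf_neq0// gt_eqF.
have dn : D ^+ j.+1 != 0 by rewrite expf_neq0// gt_eqF.
move: (e ^+ j.+1) (D ^+ j.+1) en dn (enorm z ^+ j.+1) => a b a0 b0 c.
move: ((S z - dot x z) ^+ j.+1) ((S z + dot x z) ^+ j.+1) ((-1) ^+ j.+1) => f g h.
move: (j.+1%:R : R) jn => l l0.
by field; rewrite l0 a0 b0.
Qed.

End geometry.

(** * The kernel annihilates polynomials of low degree *)

Section annihilation.
Context {R : realType} {n : nat}.
Local Notation mu := (@lebesgue_measure R).
Local Notation lam := (@lebesgue_rV R n).
Variables (k m : nat) (Q p : 'rV[R]_n -> R).
Hypotheses (n2 : (2 < n)%N) (mk : (m + 2 <= k)%N).
Hypotheses (hQ : homog k Q) (lQ : forall z, lap Q z = 0) (hp : homog m p).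

Let j := (k - 2 - m)%N.
Let M := (n + k.*2 - 2)%N.
Let K z : R := Q z * p z / enorm z ^+ M.

Let M_E : M = (n + j + (k + m))%N.
Proof. rewrite /M /j; move: n2 mk => ? ?; lia. Qed.

Let enormV_meas : measurable_fun setT (fun z : 'rV[R]_n => (enorm z ^+ M)^-1).
Proof.
apply: (measurableT_comp measurable_invr); apply: measurable_funX.
exact: measurable_enorm.
Qed.

Let mK : measurable_fun setT K.
Proof.
apply: measurable_funM => //.
exact: continuous_measurable_rV (homog_continuous (homogM hQ hp)).
Qed.

Let homK : homogneg j K.
Proof.
split=> //.
  have M0 : (M == 0)%N = false by rewrite M_E; apply/eqP; move: n2; lia.
  by rewrite /K enorm0 expr0n M0 invr0 mulr0.
move=> t z t0; rewrite /K (homog_scale _ _ (homogM hQ hp)) enormZ gtr0_norm// exprMn.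
have -> : t ^+ M = t ^+ (n + j) * t ^+ (k + m) by rewrite M_E exprD.
have h1 : t ^+ (n + j) != 0 by rewrite expf_neq0// gt_eqF.
have h2 : t ^+ (k + m) != 0 by rewrite expf_neq0// gt_eqF.
move: (t ^+ (n + j)) (t ^+ (k + m)) h1 h2 => a b a0 b0.
rewrite !invfM; move: (Q z * p z) (enorm z ^+ M)^-1 => c d.
by field; rewrite a0 b0.
Qed.

Lemma kernel_integrable x (r e : R) : 0 < e ->
  lam.-integrable setT (EFin \o (fun z => K z * \1_(pierced x r e) z)).
Proof.
move=> e0; have [C C0 hC] := homog_bound (homogM hQ hp).
pose A := `|enorm x + r|.
have rho z : pierced x r e z -> enorm z <= A.
  move=> [_ zr]; have -> : z = x - (x - z) by rewrite opprB addrC subrK.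
  apply: le_trans (ler_norm _).
  by rewrite (le_trans (enorm_triangle _ _))// lerD2l ltW.
apply: (@integrable_bounded _ _ _ (C * A ^+ (k + m) / e ^+ M) A).
- by apply: measurable_funM => //; apply: measurable_indic; exact: measurable_pierced.
- move=> z; rewrite indicE; case: (boolP (z \in _)) => [|_]; last first.
    rewrite mulr0 normr0; apply: mulr_ge0; last by rewrite invr_ge0 exprn_ge0// ltW.
    by apply: mulr_ge0 => //; apply: exprn_ge0; exact: normr_ge0.
  rewrite inE => zp; rewrite mulr1 /K normrM normfV.
  rewrite [`|enorm z ^+ M|]ger0_norm ?exprn_ge0 ?enorm_ge0//.
  have := rho z zp; case: zp => ez _ rz.
  have ez0 : 0 < enorm z by exact: lt_le_trans ez.
  apply: ler_pM => //; first by rewrite invr_ge0 exprn_ge0// enorm_ge0.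
    apply: le_trans (hC z) _; apply: ler_wpM2l => //.
    by rewrite lerXn2r// nnegrE ?enorm_ge0// normr_ge0.
  by rewrite lef_pV2 ?posrE ?exprn_gt0// lerXn2r// nnegrE ltW.
- move=> z zb; rewrite indicE memNset ?mulr0// => /rho h; apply: zb => i.
  exact: le_trans (coord_le_enorm z i) h.
Qed.

(** By [average], the integral is, up to a positive factor, that of
    [Q p q cutoff] over the whole space. Adding to it its image under
    [z |-> - z] replaces [q] by the polynomial of degree [j] of
    [symmetrized_ray], and [m + j = k - 2 < k]. *)
Theorem annihilation x (r e : R) : enorm x < r -> 0 < e -> e < r - enorm x ->
  \int[lam]_z (K z * \1_(pierced x r e) z) = 0.
Proof.
move=> xr e0 er.
pose q z : R := prim j (exit_time x r z) - prim j (e / enorm z).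
have hq z : z != 0 ->
    (\int[mu]_t (posind t * (t ^+ j.+1)^-1 * \1_(pierced x r e) (t *: z))%:E = (q z)%:E)%E.
  move=> z0; have rz : 0 < enorm z by rewrite enorm_gt0.
  have a0 : 0 < e / enorm z by rewrite divr_gt0.
  have ab : e / enorm z < exit_time x r z.
    rewrite -before_exit//; apply: le_lt_trans (enorm_triangle _ _) _.
    rewrite enormZ gtr0_norm// divfK ?gt_eqF//; lra.
  rewrite /q -(ray_integral j a0 ab); apply: eq_integral => t _.
  have [t0|t0] := leP t 0; first by rewrite posind_le0// !mul0r.
  congr (_ * _)%:E; rewrite !indicE; congr (_ %:R); congr (nat_of_bool _).
  have P1 : (t *: z \in pierced x r e) = (e <= enorm (t *: z)) && (enorm (x - t *: z) < r).
    by apply/idP/idP; rewrite inE => /andP.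
  have P2 : (t \in `[(e / enorm z), (exit_time x r z)[%classic) =
      (e / enorm z <= t < exit_time x r z).
    by apply/idP/idP; rewrite inE/= in_itv.
  by rewrite P1 P2 before_exit// enormZ gtr0_norm// ler_pdivrMr.
have n0 : (0 < n)%N by move: n2; lia.
have [iI EI] := average n0 M (measurable_pierced x r e) homK (kernel_integrable x r e0) hq.
have [P hP qP] := symmetrized_ray j xr e0.
pose G z : R := Q z * p z * cutoff (sqn z) * q z.
have GE : (fun z => radial M (enorm z) * K z * q z) = G.
  apply/funext => z; rewrite /G /K /radial sqr_enorm ger0_norm ?enorm_ge0//.
  have [->|z0] := eqVneq z 0.
    by rewrite sqn0 cutoff_out ?mul0r ?mulr0 ?mul0r//; left.
  have h : enorm z ^+ M != 0 by rewrite expf_neq0// enorm_eq0.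
  move: (enorm z ^+ M) h (q z) (cutoff (sqn z)) => a a0 b c.
  by field.
rewrite GE in iI EI.
have iG : lam.-integrable setT (EFin \o G) by exact: iI.
have iGN : lam.-integrable setT (EFin \o (fun z => G (- z))).
  have := integrable_affine 0 (_ : -1 != 0 :> R) iG.
  rewrite oppr_eq0 oner_eq0 => /(_ erefl).
  by under [X in EFin \o X]eq_fun do rewrite addr0 scaleN1r.
have EN : \int[lam]_z G (- z) = \int[lam]_z G z.
  rewrite -(Rintegral_opp 0 iG); apply: eq_Rintegral => z _; by rewrite sub0r.
have sum0 : \int[lam]_z (G z + G (- z)) = 0.
  have nk : (2 < n + k)%N by rewrite (leq_trans n2)// leq_addr.
  have mj : (m + j < k)%N by rewrite /j; move: mk; lia.
  rewrite -(harmonic_orthogonal nk hQ lQ mj (homogM hp hP) C1c_cutoff).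
  apply: eq_Rintegral => z _; have [->|z0] := eqVneq z 0.
    by rewrite /G oppr0 sqn0 cutoff_out ?mulr0 ?mul0r ?addr0//; left.
  rewrite -(qP z z0) /G sqnN (homogN z hQ) (homogN z hp) -/(q z) -/(q (- z)).
  have -> : (-1) ^+ j = (-1) ^+ k * (-1) ^+ m :> R.
    rewrite -exprD; have -> : (k + m = j + (m + 1) * 2)%N by rewrite /j; move: mk; lia.
    by rewrite exprD exprM sqrr_sign mulr1.
  move: ((-1) ^+ k) ((-1) ^+ m) (Q z) (p z) (cutoff (sqn z)) (q z) (q (- z)) => a b c d f g h.
  by ring.
rewrite RintegralD// EN -mulr2n in sum0.
move/eqP: sum0; rewrite mulrn_eq0/= EI mulf_eq0 => /orP[|/eqP//].
rewrite fine_eq0; last by rewrite ge0_fin_numE ?polar_cst_fin// ltW// polar_cst_gt0.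
by rewrite gt_eqF// polar_cst_gt0.
Qed.

End annihilation.

(** * Taylor polynomials *)

Section smooth_functions.
Context {R : realType} {n : nat}.
Implicit Types (x y z : 'rV[R]_n) (f g h p : 'rV[R]_n -> R) (i j : 'I_n) (b m : 'I_n -> nat).
Local Notation e_ i := (delta_mx ord0 i : 'rV[R]_n).

Lemma smooth_is_derive f x i : smooth f -> is_derive x (e_ i) f (partial i f x).
Proof. by move=> /(_ [::])[_ /(_ i x)] df; apply/derivableP. Qed.

Lemma smooth_partial f i : smooth f -> smooth (partial i f).
Proof. by move=> sf s; have := sf (rcons s i); rewrite foldr_rcons. Qed.

Lemma smooth_continuous f : smooth f -> continuous f.
Proof. by move=> /(_ [::])[]. Qed.

Lemma smooth_iter f i k : smooth f -> smooth (iter k (partial i) f).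
Proof. by move=> sf; elim: k => [|k ih]; [exact: sf|exact: (smooth_partial i ih)]. Qed.

(** The directions in which [mpartial] differentiates, listed with
    multiplicity: smoothness is expressed by such lists. *)
Definition mseq b (l : seq 'I_n) := flatten [seq nseq (b i) i | i <- l].

Lemma foldr_mseq b f l :
  foldr (fun i => iter (b i) (partial i)) f l = foldr partial f (mseq b l).
Proof.
elim: l => [//|i l /= ->]; rewrite foldr_cat.
by elim: (b i) => [//|k /= ->].
Qed.

Lemma partial_lin f g (c : R) i : smooth f -> smooth g ->
  partial i (fun y => f y + c * g y) = (fun y => partial i f y + c * partial i g y).
Proof.
move=> sf sg; apply/funext => y; apply: partialE; apply: is_deriveD.
  exact: smooth_is_derive.
exact: (is_deriveZ c (smooth_is_derive y i sg)).
Qed.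

Lemma foldr_partial_lin f g (c : R) s : smooth f -> smooth g ->
  foldr partial (fun y => f y + c * g y) s =
  (fun y => foldr partial f s y + c * foldr partial g s y).
Proof.
elim/last_ind: s f g => [//|s i ih] f g sf sg.
rewrite !foldr_rcons (partial_lin c i sf sg).
exact: ih (smooth_partial i sf) (smooth_partial i sg).
Qed.

Lemma smooth_lin f g (c : R) : smooth f -> smooth g -> smooth (fun y => f y + c * g y).
Proof.
move=> sf sg s; rewrite foldr_partial_lin//; have [cf df] := sf s; have [cg dg] := sg s.
split.
  move=> y; apply: continuousD; first exact: cf.
  by apply: continuousM; [exact: cst_continuous|exact: cg].
move=> i y; apply: derivableD; first exact: df.
exact: (@derivableZ _ _ _ _ c).
Qed.

Lemma homog_foldr_partial d p s : homog d p -> exists e, homog e (foldr partial p s).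
Proof.
move=> hp; elim: s => [|i s [e he]] /=; first by exists d.
by exists e.-1; exact: homog_partial.
Qed.

Lemma partial_translate f x i : (forall y, derivable f y (e_ i)) ->
  partial i (fun y => f (y - x)) = (fun y => partial i f (y - x)).
Proof.
move=> df; apply/funext => y; apply: partialE; apply/is_derive_line.
have /is_derive_line := derivableP (df (y - x)).
by under eq_fun do rewrite addrA.
Qed.

Lemma foldr_partial_translate d p x s : homog d p ->
  foldr partial (fun y => p (y - x)) s = (fun y => foldr partial p s (y - x)).
Proof.
move=> hp; elim: s => //= i s ->; have [e he] := homog_foldr_partial s hp.
by apply: partial_translate => y; exact: (homog_is_derive he y i).(ex_derive).
Qed.

Lemma smooth_translate d p x : homog d p -> smooth (fun y => p (y - x)).
Proof.
move=> hp s; rewrite (foldr_partial_translate x s hp).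
have [e he] := homog_foldr_partial s hp; split.
  move=> y; apply: (@continuous_comp _ _ _ (fun y => y - x)).
    by apply: continuousB; [exact: cvg_id|exact: cst_continuous].
  exact: homog_continuous he _.
move=> i y; apply/derivable1P.
have /derivable1P := (homog_is_derive he (y - x) i).(ex_derive).
by under eq_fun do rewrite addrA.
Qed.

Lemma smooth_sum (I : Type) (r : seq I) (P : pred I) (c : I -> R) (F : I -> 'rV[R]_n -> R) f :
  smooth f -> (forall a, smooth (F a)) ->
  smooth (fun y => f y - \sum_(a <- r | P a) c a * F a y) /\
  forall s y, foldr partial (fun y => f y - \sum_(a <- r | P a) c a * F a y) s y =
    foldr partial f s y - \sum_(a <- r | P a) c a * foldr partial (F a) s y.
Proof.
move=> sf sF; elim: r => [|a r [ih1 ih2]].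
  have -> : (fun y => f y - \sum_(a <- [::] | P a) c a * F a y) = f.
    by apply/funext => y; rewrite big_nil subr0.
  by split=> // s y; rewrite big_nil subr0.
case: (boolP (P a)) => Pa; last first.
  have -> : (fun y => f y - \sum_(a <- a :: r | P a) c a * F a y) =
            (fun y => f y - \sum_(a <- r | P a) c a * F a y).
    by apply/funext => y; rewrite big_cons (negbTE Pa).
  by split=> // s y; rewrite ih2 big_cons (negbTE Pa).
have -> : (fun y => f y - \sum_(a <- a :: r | P a) c a * F a y) =
          (fun y => (f y - \sum_(a <- r | P a) c a * F a y) + (- c a) * F a y).
  by apply/funext => y; rewrite big_cons Pa; ring.
split; first exact: (smooth_lin (- c a) ih1 (sF a)).
move=> s y; rewrite (foldr_partial_lin (- c a) s ih1 (sF a)) ih2 big_cons Pa.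
by move: (foldr partial f s y) (foldr partial (F a) s y) (\sum_(_ <- r | _) _) => u v w; ring.
Qed.

End smooth_functions.

Section taylor_remainder.
Context {R : realType} {n : nat}.
Implicit Types (x y z : 'rV[R]_n) (f g h p : 'rV[R]_n -> R) (i j : 'I_n) (m : 'I_n -> nat).
Local Notation e_ i := (delta_mx ord0 i : 'rV[R]_n).

Lemma line_bound (g dg : R -> R) (B rho t : R) :
  (forall s : R, is_derive s (1 : R) g (dg s)) -> (forall s, `|s| <= rho -> `|dg s| <= B) ->
  `|t| <= rho -> `|g t - g 0| <= B * rho.
Proof.
move=> hg hB tr.
have cg (a b : R) : {within `[a, b], continuous g}.
  apply: continuous_subspaceT => s.
  by apply/differentiable_continuous/derivable1_diffP; exact: (hg s).(ex_derive).
have [t0|t0] := leP 0 t.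
  have [c] := MVT_segment t0 (fun s _ => hg s) (cg 0 t).
  rewrite in_itv/= => /andP[c0 ct] ->; rewrite subr0 normrM ler_pM//.
  by apply: hB; apply: le_trans tr; rewrite !ger0_norm// (le_trans c0).
have [c] := MVT_segment (ltW t0) (fun s _ => hg s) (cg t 0).
rewrite in_itv/= => /andP[c0 ct] E; rewrite -opprB E sub0r normrN normrM normrN ler_pM//.
by apply: hB; apply: le_trans tr; rewrite !ler0_norm ?lerN2// ltW.
Qed.

(** The hypotheses bound the derivatives of [h] along [e_j] at the base point
    [y] instead of asking that they vanish, because [vanishing_bound] uses it
    at points other than the centre of the expansion. *)
Lemma taylor_line (N : nat) j h y (C rho : R) : smooth h -> 0 <= rho ->
  (forall b, (b < N)%N -> `|iter b (partial j) h y| <= C * rho ^+ (N - b)) ->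
  (forall t, `|t| <= rho -> `|iter N (partial j) h (t *: e_ j + y)| <= C) ->
  forall t, `|t| <= rho -> `|h (t *: e_ j + y)| <= (N.+1)%:R * C * rho ^+ N.
Proof.
elim: N h => [|N ih] h sh r0 hb hN t tr.
  by rewrite mul1r expr0 mulr1; exact: hN.
have h1 : forall t, `|t| <= rho -> `|partial j h (t *: e_ j + y)| <= N.+1%:R * C * rho ^+ N.
  apply: (ih _ (smooth_partial j sh) r0).
    by move=> b bN; have := hb b.+1 bN; rewrite iterSr subSS.
  by move=> s sr; have := hN s sr; rewrite iterSr.
have dl s : is_derive s (1 : R) (fun t : R => h (t *: e_ j + y)) (partial j h (s *: e_ j + y)).
  by apply: is_derive_line_at; exact: smooth_is_derive.
have := line_bound dl h1 tr; rewrite scale0r add0r => h2.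
have := hb 0%N isT; rewrite /= subn0 => h3.
rewrite -[h _](subrK (h y)) (le_trans (ler_normD _ _))//.
rewrite -[N.+2%:R]natr1 mulrDl mul1r mulrDl lerD//.
by rewrite exprSr mulrA.
Qed.

Lemma bounded_on_box f x (M : R) : 0 <= M -> continuous f ->
  exists2 C, 0 <= C & forall y, (forall i, `|y ord0 i - x ord0 i| <= M) -> `|f y| <= C.
Proof.
move=> M0 cf.
pose A : set 'rV[R]_n := [set v | forall i, v ord0 i \in `[x ord0 i - M, x ord0 i + M]].
have cA : compact A.
  apply: (@rV_compact _ _ (fun i => `[x ord0 i - M, x ord0 i + M]%classic)).
  by move=> i; exact: segment_compact.
have Ax : A x by move=> i; rewrite in_itv/= gerBl// lerDl M0.
have cn : continuous (fun y : 'rV[R]_n => `|f y|).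
  move=> y; apply: (@continuous_comp _ _ _ f (fun u : R => `|u|)); first exact: cf.
  exact: norm_continuous.
have cf' : {within A, continuous (fun y : 'rV[R]_n => `|f y|)} by exact: continuous_subspaceT.
have [c _ hc] := EVT_max_rV (ex_intro _ x Ax) cA cf'.
exists `|f c| => // y hy; apply: hc; rewrite inE => i.
by rewrite in_itv/= -ler_distl.
Qed.

(** The point [y] with its [j]-th coordinate moved back to that of [x]. *)
Definition reset (j : 'I_n) x y : 'rV[R]_n :=
  \row_i (if i == j then x ord0 i else y ord0 i).

(** Induction on the list [l] of the coordinates that may differ between [x]
    and [y]. The derivatives of [h] along the last one, [j], satisfy the same
    hypotheses with fewer coordinates and a smaller order, hence they are small
    at [y' = reset j x y]; [taylor_line] carries the bound on [h] from [y'] to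
    [y] along [e_j]. *)
Lemma vanishing_bound (l : seq 'I_n) : uniq l -> forall N h x (M : R), 0 <= M -> smooth h ->
  (forall m, (\sum_(i <- l) m i <= N)%N ->
     foldr (fun i => iter (m i) (partial i)) h l x = 0) ->
  exists2 C, 0 <= C & forall y (rho : R), 0 <= rho <= M ->
    (forall i, i \in l -> `|y ord0 i - x ord0 i| <= rho) ->
    (forall i, i \notin l -> y ord0 i = x ord0 i) -> `|h y| <= C * rho ^+ N.+1.
Proof.
elim/last_ind: l => [|l j ih] ul N h x M M0 sh h0.
  exists 0 => // y rho _ _ hy; have -> : y = x by apply/rowP => i; exact: hy.
  by have := h0 (fun=> 0%N); rewrite big_nil => /(_ isT) /= ->; rewrite normr0 mul0r.
move: ul; rewrite rcons_uniq => /andP[jl ul].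
have hC b : exists C : R, 0 <= C /\ ((b <= N)%N -> forall y (rho : R), 0 <= rho <= M ->
    (forall i, i \in l -> `|y ord0 i - x ord0 i| <= rho) ->
    (forall i, i \notin l -> y ord0 i = x ord0 i) ->
    `|iter b (partial j) h y| <= C * rho ^+ (N.+1 - b)).
  have [bN|_] := leqP b N; last by exists 0.
  have [|C C0 CP] := ih ul (N - b)%N (iter b (partial j) h) x M M0 (smooth_iter j b sh).
    move=> m mN; pose m' i := if i == j then b else m i.
    have E i : i \in l -> m' i = m i by rewrite /m'; case: eqP => // -> jl'; rewrite jl' in jl.
    have mj : m' j = b by rewrite /m' eqxx.
    have := h0 m'; rewrite foldr_rcons /= mj.
    have -> : foldr (fun i => iter (m' i) (partial i)) (iter b (partial j) h) l =
              foldr (fun i => iter (m i) (partial i)) (iter b (partial j) h) l.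
      by rewrite !foldr_mseq /mseq; congr foldr; congr flatten; apply/eq_in_map => i /E ->.
    apply; rewrite -cats1 big_cat big_seq1 /= mj.
    rewrite (eq_big_seq m) => [|i il]; last exact: E.
    by rewrite -(subnK bN) leq_add2r.
  by exists C; split => // _; rewrite subSn.
have [C CP] := choice hC.
have sN := smooth_iter j N.+1 sh.
have [B B0 hB] := bounded_on_box x M0 (smooth_continuous sN).
pose CC := \sum_(b < N.+1) C b + B.
have CC0 : 0 <= CC by rewrite addr_ge0// sumr_ge0// => b _; exact: (CP b).1.
exists (N.+2%:R * CC); first by rewrite mulr_ge0.
move=> y rho /andP[r0 rM] yl ynl; pose y' := reset j x y.
have y'l i : i \in l -> `|y' ord0 i - x ord0 i| <= rho.
  move=> il; rewrite mxE; case: eqP => [|_]; first by rewrite subrr normr0.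
  by apply: yl; rewrite mem_rcons inE il orbT.
have y'nl i : i \notin l -> y' ord0 i = x ord0 i.
  rewrite mxE; case: eqP => // /eqP ij il; apply: ynl.
  by rewrite mem_rcons inE negb_or ij.
have yj : `|y ord0 j - x ord0 j| <= rho by apply: yl; rewrite mem_rcons inE eqxx.
have yE : y = (y ord0 j - x ord0 j) *: e_ j + y'.
  apply/rowP => i; rewrite !mxE eqxx /=; case: eqP => [->|_].
    by rewrite mulr1 subrK.
  by rewrite mulr0 add0r.
rewrite yE; apply: taylor_line => //.
- move=> b bN; apply: le_trans ((CP b).2 _ y' rho _ y'l y'nl) _ => //; first by rewrite r0.
  apply: ler_wpM2r; first exact: exprn_ge0.
  rewrite /CC (bigD1 (Ordinal bN))//= -addrA lerDl addr_ge0// sumr_ge0// => a _.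
  exact: (CP a).1.
- move=> t tr; apply: le_trans (_ : B <= CC); last first.
    by rewrite lerDr sumr_ge0// => b _; exact: (CP b).1.
  apply: hB => i; rewrite !mxE eqxx /=; case: eqP => [->|_].
    by rewrite mulr1 addrK (le_trans tr).
  rewrite mulr0 add0r; have [il|inl] := boolP (i \in rcons l j).
    by apply: le_trans rM; exact: yl.
  by rewrite ynl// subrr normr0.
Qed.

Lemma partial_mpow i (b : 'I_n -> nat) (c : R) :
  partial i (fun z => c * mpow z b) =
  (fun z => c * (b i)%:R * mpow z (fun k => if k == i then (b i).-1 else b k)).
Proof.
apply/funext => z; apply: partialE; apply/is_derive_line.
pose A := \prod_(k < n | k != i) z ord0 k ^+ b k.
have -> : (fun t : R => c * mpow (t *: e_ i + z) b) =
    (fun t : R => c * A * (t + z ord0 i) ^+ b i).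
  apply/funext => t; rewrite /mpow (bigD1 i)//=.
  have -> : (t *: e_ i + z) ord0 i = t + z ord0 i by rewrite !mxE !eqxx /= mulr1.
  rewrite -mulrA [A * _]mulrC.
  congr (_ * (_ * _)); apply: eq_bigr => k /negPf ki.
  by rewrite !mxE eqxx ki mulr0 add0r.
rewrite /mpow [in X in is_derive _ _ _ X](bigD1 i)//= eqxx.
rewrite (eq_bigr (fun k => z ord0 k ^+ b k)) => [|k /negPf ->//]; rewrite -/A.
have h1 : is_derive (0 : R) (1 : R) (fun t => t + z ord0 i) (1 + 0).
  exact: (is_deriveD (is_derive_id (0 : R) 1) (is_derive_cst (z ord0 i) (0 : R) 1)).
have h2 : is_derive (0 : R) (1 : R) (fun t : R => (t + z ord0 i) ^+ b i)
    ((b i)%:R * z ord0 i ^+ (b i).-1).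
  have := @is_deriveX _ _ _ (b i) _ _ _ h1.
  by rewrite exprfctE /GRing.scale/= add0r addr0 mulr1.
have := is_deriveZ (c * A) h2; rewrite /GRing.scale/=.
by congr is_derive; move: (z ord0 i ^+ _) => u; ring.
Qed.

Lemma iter_partial_mpow i k (b : 'I_n -> nat) (c : R) :
  iter k (partial i) (fun z => c * mpow z b) =
  (fun z => c * (b i ^_ k)%:R * mpow z (fun a => if a == i then (b i - k)%N else b a)).
Proof.
elim: k => [|k ih] /=.
  apply/funext => z; rewrite ffactn0 mulr1 subn0; congr (_ * mpow _ _).
  by apply/funext => a; case: eqP => // ->.
rewrite ih partial_mpow eqxx; apply/funext => z; rewrite ffactnSr natrM.
rewrite -!mulrA; congr (_ * (_ * (_ * mpow _ _))).
by apply/funext => a; case: eqP => // _; rewrite subnS.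
Qed.

Lemma foldr_partial_mpow m l (b : 'I_n -> nat) (c : R) : uniq l ->
  foldr (fun i => iter (m i) (partial i)) (fun z => c * mpow z b) l =
  (fun z => c * (\prod_(i <- l) (b i ^_ m i))%:R *
     mpow z (fun a => if a \in l then (b a - m a)%N else b a)).
Proof.
elim: l => [|i l ih] /=.
  by move=> _; apply/funext => z; rewrite big_nil mulr1.
move=> /andP[il ul]; rewrite ih// iter_partial_mpow (negbTE il); apply/funext => z.
rewrite big_cons mulnC natrM -!mulrA; congr (_ * (_ * (_ * mpow _ _))).
apply/funext => a; rewrite inE; case: eqP => // ->.
by rewrite (negbTE il).
Qed.

End taylor_remainder.

Section taylor_bound.
Context {R : realType} {n : nat}.
Implicit Types (x y z : 'rV[R]_n) (f g h p : 'rV[R]_n -> R) (i j : 'I_n) (m b : 'I_n -> nat).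

Lemma mpartial_mpow_at m b x :
  mpartial m (fun y => mpow (y - x) b) x =
  if [forall i, m i == b i] then (mfact b)%:R else 0.
Proof.
rewrite /mpartial foldr_mseq (foldr_partial_translate x _ (homog_mpow b)) -foldr_mseq subrr.
have -> : (fun z : 'rV[R]_n => mpow z b) = (fun z => 1 * mpow z b).
  by apply/funext => z; rewrite mul1r.
rewrite (foldr_partial_mpow m b 1 (enum_uniq 'I_n)) mul1r.
have -> : (fun a => if a \in enum 'I_n then (b a - m a)%N else b a) = (fun a => (b a - m a)%N).
  by apply/funext => a; rewrite mem_enum.
rewrite big_enum /=; case: forallP => [E|nE].
  rewrite (eq_bigr (fun i => (b i)`!)) => [|i _]; last by rewrite (eqP (E i)) ffactnn.
  rewrite (_ : mpow _ _ = 1) ?mulr1//.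
  by rewrite /mpow big1// => i _; rewrite (eqP (E i)) subnn expr0.
have [i mi] : exists i, m i != b i.
  by apply/existsP; rewrite -negb_forall; apply/forallP.
move: mi; rewrite neq_ltn => /orP[mb|bm].
  rewrite (_ : mpow _ _ = 0) ?mulr0//.
  by rewrite /mpow (bigD1 i)//= mxE expr0n subn_eq0 leqNgt mb mul0r.
by rewrite (bigD1 i)//= (ffact_small bm) mul0n mul0r.
Qed.

(** At [x], the derivative of index [m] of the monomial of index [b] is [b!] if
    [m = b], and 0 otherwise. *)
Lemma taylor_contact (N : nat) f x m : smooth f -> (mdeg m <= N)%N ->
  smooth (fun y => f y - taylor N x f y) /\
  mpartial m (fun y => f y - taylor N x f y) x = 0.
Proof.
move=> sf mN.
pose c (a : {ffun 'I_n -> 'I_N.+1}) : R := mpartial (val \o a) f x / (mfact (val \o a))%:R.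
pose F (a : {ffun 'I_n -> 'I_N.+1}) y : R := mpow (y - x) (val \o a).
have sF a : smooth (F a) by exact: smooth_translate (homog_mpow _).
have [s1 s2] := smooth_sum (index_enum _)
  (fun a : {ffun 'I_n -> 'I_N.+1} => (mdeg (val \o a) <= N)%N) c sf sF.
split; first exact: s1.
rewrite /mpartial foldr_mseq; apply: etrans (s2 _ x) _.
have mlt i : (m i < N.+1)%N by rewrite ltnS (leq_trans _ mN)// /mdeg (bigD1 i)//= leq_addr.
pose a0 : {ffun 'I_n -> 'I_N.+1} := [ffun i => Ordinal (mlt i)].
have a0E : val \o a0 = m by apply/funext => i; rewrite /= ffunE.
rewrite (bigD1 a0)/=; last by rewrite a0E.
rewrite -foldr_mseq -/(mpartial m f x).
have val_ a : foldr partial (F a) (mseq m (enum 'I_n)) x =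
    if [forall i, m i == val (a i)] then (mfact (val \o a))%:R else 0.
  by rewrite -foldr_mseq; exact: mpartial_mpow_at.
rewrite big1 => [|a /andP[_ aa0]]; last first.
  rewrite val_ ifN ?mulr0//; apply: contra aa0 => /forallP E.
  by apply/eqP/ffunP => i; apply/val_inj; rewrite -(eqP (E i)) ffunE.
rewrite val_ ifT; last by apply/forallP => i; rewrite ffunE.
rewrite /c a0E divfK ?addr0 ?subrr//.
by rewrite pnatr_eq0 -lt0n prodn_gt0// => i; exact: fact_gt0.
Qed.

Lemma taylor_bound (N : nat) f x (M : R) : smooth f -> 0 <= M ->
  exists2 C, 0 <= C & forall y, enorm (y - x) <= M ->
    `|f y - taylor N x f y| <= C * enorm (y - x) ^+ N.+1.
Proof.
move=> sf M0.
have m0 : (mdeg (fun _ : 'I_n => 0) <= N)%N by rewrite /mdeg big1.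
have hv m : (\sum_(i <- enum 'I_n) m i <= N)%N ->
    foldr (fun i => iter (m i) (partial i)) (fun y => f y - taylor N x f y) (enum 'I_n) x = 0.
  by move=> mN; apply: (taylor_contact x sf _).2; rewrite /mdeg -big_enum.
have [C C0 hC] := vanishing_bound (enum_uniq 'I_n) M0 (taylor_contact x sf m0).1 hv.
exists C => // y yM; apply: hC.
- by rewrite enorm_ge0.
- by move=> i _; have := coord_le_enorm (y - x) i; rewrite !mxE.
- by move=> i; rewrite mem_enum.
Qed.

Lemma partial_open0 (U : set 'rV[R]_n) f s : open U -> (forall y, U y -> f y = 0) ->
  forall y, U y -> foldr partial f s y = 0.
Proof.
move=> oU f0; elim: s => [|i s ih] y Uy; first exact: f0.
apply: partialE.
have yU : \forall z \near y, (fun=> 0) z = foldr partial f s z.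
  have : nbhs y U by exact: open_nbhs_nbhs.
  by apply: filterS => z Uz; rewrite (ih z Uz).
exact: near_eq_is_derive yU (is_derive_cst _ _ _).
Qed.

Lemma taylor_open0 N (U : set 'rV[R]_n) f x : open U -> (forall y, U y -> f y = 0) ->
  U x -> forall y, taylor N x f y = 0.
Proof.
move=> oU f0 Ux y; rewrite /taylor big1// => a _.
by rewrite /mpartial foldr_mseq (partial_open0 _ oU f0 Ux) !mul0r.
Qed.

End taylor_bound.

(** * The weak singularity at the origin *)

Section singular_weight.
Context {R : realType} {n : nat}.
Local Notation mu := (@lebesgue_measure R).
Local Notation lam := (@lebesgue_rV R n).
Hypothesis n1 : (1 < n)%N.
Implicit Types (z : 'rV[R]_n) (e : R).

(** The size of the kernel times the Taylor remainder, near [x]. *)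
Definition weak_singularity e z : R := (enorm z ^+ n.-1)^-1 * \1_[set z | enorm z < e] z.

Lemma weak_singularity_ge0 e z : 0 <= weak_singularity e z.
Proof. by rewrite mulr_ge0// invr_ge0 exprn_ge0// enorm_ge0. Qed.

Lemma measurable_weak_singularity e : measurable_fun setT (weak_singularity e).
Proof.
apply: measurable_funM.
  apply: (measurableT_comp measurable_invr); apply: measurable_funX.
  exact: measurable_enorm.
apply: measurable_indic.
rewrite (_ : [set z | enorm z < e] = @enorm R n @^-1` `]-oo, e[%classic).
  by rewrite -[X in measurable X]setTI; exact: measurable_enorm.
by apply/seteqP; split => z; rewrite /= in_itv.
Qed.

(** In [polar_tonelli] for a weight supported in an annulus, the inner integral
    is at most [9 int_0^1 |z|^(1 - n) dt <= 9] on the annulus and 0 off it; so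
    the left-hand side is finite. The right-hand side is a positive multiple of
    the integral. *)
Let W1 : lam.-integrable setT (EFin \o weak_singularity 1).
Proof.
apply/integrableP; split; first by apply/measurable_EFinP; exact: measurable_weak_singularity.
pose F z : \bar R := (weak_singularity 1 z)%:E.
rewrite (eq_integral F) => [|z _]; last by rewrite gee0_abs// lee_fin weak_singularity_ge0.
have mF : measurable_fun setT F by apply/measurable_EFinP; exact: measurable_weak_singularity.
have F0 z : (0 <= F z)%E by rewrite lee_fin weak_singularity_ge0.
have n0 : (0 < n)%N by exact: ltnW.
have F00 : F 0 = 0%E.
  rewrite /F /weak_singularity enorm0.
  rewrite expr0n (_ : (n.-1 == 0)%N = false) ?invr0 ?mul0r//.
  by apply/eqP; move: n1; lia.
have := polar_tonelli (@measurable_radial R 0) (@radial_ge0 R 0) n0 mF F0 F00.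
set L := (\int[lam]_z _)%E => E.
have Lfin : (L < +oo)%E.
  apply: (@le_lt_trans _ _ (\int[lam]_z (9%:E * (\1_(@box R n 2) z)%:E))%E); last first.
    rewrite ge0_integralZl//; last first.
      by apply/measurable_EFinP; apply: measurable_indic; exact: measurable_box.
    rewrite integral_indic//; last exact: measurable_box.
    by rewrite setIT lte_mul_pinfty//; exact: lebesgue_rV_box.
  apply: ge0_le_integral => //.
  - move=> z _; apply: integral_ge0 => t _; rewrite mule_ge0// lee_fin mulr_ge0 ?radial_ge0//.
    have [t0|t0] := leP t 0; first by rewrite posind_le0// mul0r.
    by rewrite posind_gt0// mul1r exprn_ge0// ltW.
  - exact: measurable_polar_inner (@measurable_radial R 0) (@radial_ge0 R 0) _ mF F0.
  - apply/measurable_EFinP; apply: measurable_funM => //; apply: measurable_indic.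
    exact: measurable_box.
  move=> z _.
  case: (boolP ((1 < enorm z) && (enorm z < 2))) => [/andP[z1 z2]|zout]; last first.
    rewrite integral0_eq; first by rewrite -EFinM lee_fin mulr_ge0.
    move=> t _; rewrite /radial cutoff_out ?mul0r ?mul0e//.
    have r0 := enorm_ge0 z.
    by move: zout; rewrite negb_and -!leNgt expr2 => /orP[h|h]; [left|right]; nra.
  have zb : box 2 z by move=> i; apply: le_trans (coord_le_enorm z i) (ltW z2).
  rewrite indicE mem_set// mule1.
  apply: (@le_trans _ _
    (\int[mu]_t (9%:E * (\1_(`]0, 1[%classic : set R) t)%:E))%E); last first.
    rewrite ge0_integralZl//; last by apply/measurable_EFinP.
    rewrite integral_indic//= setIT lebesgue_measure_itv/= lte_fin ltr01.
    by rewrite oppr0 addr0 mule1.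
  apply: ge0_le_integral => //.
  - move=> t _; rewrite mule_ge0// lee_fin mulr_ge0 ?radial_ge0//.
    have [t0|t0] := leP t 0; first by rewrite posind_le0// mul0r.
    by rewrite posind_gt0// mul1r exprn_ge0// ltW.
  - apply: emeasurable_funM.
      apply/measurable_EFinP; apply: measurable_funM => //; apply: measurable_funM => //.
      exact: measurable_posind.
    have ms : measurable_fun setT (fun t : measurableTypeR R => t *: z).
      exact: (measurableT_comp (@measurable_scale R n) (measurable_pair1 z)).
    exact: (measurableT_comp mF ms).
  - by apply/measurable_EFinP; apply: measurable_funM.
  move=> t _; rewrite /F -!EFinM lee_fin.
  have [t0|t0] := leP t 0.
    by rewrite posind_le0// mul0r mulr0 mul0r mulr_ge0.
  rewrite posind_gt0// mul1r /weak_singularity enormZ gtr0_norm// !indicE.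
  have [t1|t1] := ltP t 1; last first.
    rewrite memNset ?mulr0 ?mulr_ge0//= enormZ gtr0_norm//; apply/negP; rewrite -leNgt.
    by rewrite -[leLHS]mulr1 ler_pM// ltW.
  rewrite [t \in _]mem_set ?mulr1; last by rewrite /= in_itv/= t0 t1.
  have r9 : radial 0 (enorm z) <= 9 by rewrite /radial expr0 mulr1 cutoff_le9.
  have r0 : 0 < enorm z by exact: lt_trans z1.
  have p1 : 0 < t ^+ n.-1 by exact: exprn_gt0.
  have p2 : 1 <= enorm z ^+ n.-1 by rewrite exprn_ege1// ltW.
  set b := nat_of_bool _.
  have b1 : b%:R <= 1 :> R by rewrite lern1 leq_b1.
  have key : t ^+ n.-1 * ((t * enorm z) ^+ n.-1)^-1 <= 1.
    rewrite exprMn invfM mulrA mulfV ?gt_eqF// mul1r invf_le1//.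
    by rewrite (lt_le_trans ltr01).
  rewrite -[leRHS]mulr1 -mulrA; apply: ler_pM => //; first exact: radial_ge0.
    rewrite mulr_ge0//; first exact: ltW.
    by rewrite mulr_ge0// invr_ge0 exprn_ge0// mulr_ge0// ltW.
  rewrite mulrA -[leRHS]mulr1; apply: ler_pM => //.
  by rewrite mulr_ge0// ?invr_ge0 ?exprn_ge0// ?mulr_ge0// ltW.
rewrite ltNge leye_eq; apply/negP => /eqP I.
by move: Lfin; rewrite E I gt0_muley ?ltxx// polar_cst_gt0.
Qed.

(** Scaling: [weak_singularity e z = e^(1 - n) weak_singularity 1 (z / e)], and
    the change of variable contributes [e^n]. *)
Lemma integral_weak_singularity : exists A : R, forall e, 0 < e ->
  lam.-integrable setT (EFin \o weak_singularity e) /\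
  \int[lam]_z weak_singularity e z = e * A.
Proof.
exists (\int[lam]_z weak_singularity 1 z) => e e0.
have en : e != 0 by rewrite gt_eqF.
have ei : e^-1 != 0 by rewrite invr_eq0.
have E : weak_singularity e = (fun z => (e ^+ n.-1)^-1 * weak_singularity 1 (e^-1 *: z + 0)).
  apply/funext => z; rewrite /weak_singularity addr0 enormZ gtr0_norm ?invr_gt0// exprMn exprVn.
  rewrite invfM invrK !mulrA mulVf ?expf_neq0// mul1r; congr (_ * _).
  rewrite !indicE; congr (nat_of_bool _)%:R; apply/idP/idP; rewrite !inE/=.
    by rewrite enormZ gtr0_norm ?invr_gt0// mulrC ltr_pdivrMr// mul1r.
  by rewrite enormZ gtr0_norm ?invr_gt0// mulrC ltr_pdivrMr// mul1r.
have i1 := integrable_affine 0 ei W1.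
rewrite E; split; first exact: (integrableZl measurableT (e ^+ n.-1)^-1 i1).
rewrite RintegralZl// Rintegral_affine// normfV gtr0_norm// exprVn invrK mulrA.
congr (_ * _); have n0 : (0 < n)%N by exact: ltnW.
have -> : e ^+ n = e ^+ n.-1 * e by rewrite -exprSr prednK.
by rewrite mulKf// expf_neq0.
Qed.

End singular_weight.

(** * The principal value *)

Section indicator.
Context d (T : measurableType d) (R : realType) (mu : {measure set T -> \bar R}).

Lemma Rintegral_indicE (D : set T) (g : T -> R) :
  \int[mu]_(y in D) g y = \int[mu]_y (g y * \1_D y).
Proof.
rewrite Rintegral_mkcond; apply: eq_Rintegral => y _.
by rewrite patchE indicE; case: ifP => _; rewrite ?mulr1 ?mulr0.
Qed.

Lemma integrable_indicE (D : set T) (g : T -> R) : measurable D ->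
  mu.-integrable D (EFin \o g) <->
  mu.-integrable setT (EFin \o (fun y => g y * \1_D y)).
Proof.
move=> mD; rewrite (integrable_mkcond _ mD).
rewrite (_ : (EFin \o g) \_ D = EFin \o (fun y => g y * \1_D y))//.
apply/funext => y; rewrite patchE /= indicE.
by case: ifP => _; rewrite ?mulr1 ?mulr0.
Qed.

End indicator.

Lemma kernel_exponent n k : (2 < n)%N -> (2 <= k)%N ->
  (n + k.*2 - 2 = k + (k - 2).+1 + n.-1)%N.
Proof. by lia. Qed.

Section principal_value.
Context {R : realType} {n : nat}.
Local Notation lam := (@lebesgue_rV R n).
Variables (k : nat) (Y Q f : 'rV[R]_n -> R).
Hypotheses (n2 : (2 < n)%N) (k2 : (2 <= k)%N).
Implicit Types (y z : 'rV[R]_n) (e : R).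
Local Notation M := (n + k.*2 - 2)%N.
Hypotheses (hQ : homog k Q) (lQ : forall z, lap Q z = 0).
Hypothesis YQ : forall z, z != 0 -> Y z = Q z / enorm z ^+ M.
Hypothesis sf : smooth f.
Variables (r : R) (r0 : 0 < r).
Hypothesis fr : forall y, r <= enorm y -> f y = 0.
Variable x : 'rV[R]_n.
Let T := taylor (k - 2) x f.
Let K z : R := Q z / enorm z ^+ M.

Let ball0E y : eball 0 r y = (enorm y < r) :> Prop.
Proof. by rewrite /eball/= subr0. Qed.

Let mball c s : measurable (eball c s : set 'rV[R]_n).
Proof.
rewrite (_ : eball c s =
  (fun y : 'rV[R]_n => enorm (y - c)) @^-1` `]-oo, s[%classic); last first.
  by apply/seteqP; split => z; rewrite /eball /= in_itv.
have mx : measurable_fun setT (fun y : 'rV[R]_n => enorm (y - c)).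
  have := measurableT_comp (@measurable_enorm R n) (measurable_affine_rV 1 (- c)).
  by under eq_fun do rewrite /= scale1r.
by rewrite -[X in measurable X]setTI; exact: mx.
Qed.

Let mK : measurable_fun setT K.
Proof.
apply: measurable_funM; first exact: continuous_measurable_rV (homog_continuous hQ).
apply: (measurableT_comp measurable_invr); apply: measurable_funX.
exact: measurable_enorm.
Qed.

Let mKx : measurable_fun setT (fun y => K (x - y)).
Proof.
have := measurableT_comp mK (measurable_affine_rV (-1) x).
by under eq_fun do rewrite /= scaleN1r addrC.
Qed.

Let pierced_sub e y : \1_(pierced x r e) (x - y) = \1_(eball 0 r) y * \1_(~` eball x e) y :> R.
Proof.
rewrite !indicE -natrM mulnb; congr (nat_of_bool _)%:R.
have E : enorm (x - (x - y)) = enorm y by rewrite opprB addrC subrK.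
have E2 : enorm (y - x) = enorm (x - y) by rewrite -enormN opprB.
apply/idP/idP.
  rewrite inE => -[h1 h2]; apply/andP; split; rewrite inE; first by rewrite ball0E -E.
  by rewrite /eball/= E2; apply/negP; rewrite -leNgt.
move=> /andP[]; rewrite !inE ball0E => h1; rewrite /eball/= E2 => /negP h2.
by split; [rewrite leNgt|rewrite E].
Qed.

Let f_ball y : f y * \1_(eball 0 r) y = f y.
Proof.
rewrite indicE; case: (boolP (y \in _)) => [_|/negP yr]; first by rewrite mulr1.
rewrite fr ?mulr0// leNgt; apply/negP => h; apply: yr; by rewrite inE ball0E.
Qed.

Let far_neq0 e y : 0 < e -> (~` eball x e) y -> x - y != 0.
Proof.
move=> e0; rewrite /eball/= => h; apply/eqP => xy; apply: h.
by rewrite -enormN opprB xy enorm0.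
Qed.

Let truncE e (g : 'rV[R]_n -> R) y : 0 < e -> (forall y, g y * \1_(eball 0 r) y = g y) ->
  Y (x - y) * g y * \1_(~` eball x e) y = K (x - y) * \1_(pierced x r e) (x - y) * g y.
Proof.
move=> e0 gr; rewrite pierced_sub -[in LHS](gr y).
rewrite [\1_(~` _) y]indicE; case: (boolP (y \in _)) => [|_]; last by rewrite !(mulr0, mul0r).
rewrite inE => /(far_neq0 e0) /YQ ->.
by rewrite /K !mulr1; ring.
Qed.

Let integrable_pierced e : 0 < e ->
  lam.-integrable setT (EFin \o (fun y => K (x - y) * \1_(pierced x r e) (x - y))).
Proof.
move=> e0; have mk0 : (0 + 2 <= k)%N by [].
have n1 : (-1 : R) != 0 by rewrite oppr_eq0 oner_eq0.
have := integrable_affine x n1 (kernel_integrable hQ (homog_cst 1) x r e0).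
apply: eq_integrable => // y _ /=.
by rewrite scaleN1r [- y + x]addrC mulr1.
Qed.

Lemma integrable_truncated e : 0 < e ->
  lam.-integrable (~` eball x e) (fun y => (Y (x - y) * f y)%:E).
Proof.
move=> e0; apply/(integrable_indicE lam (fun y => Y (x - y) * f y) (measurableC (mball x e))).
have [C C0 hC] := bounded_on_box 0 (ltW r0) (smooth_continuous sf).
have fC y : `|f y| <= C.
  have [yr|yr] := ltP (enorm y) r; last by rewrite fr// normr0.
  by apply: hC => i; rewrite mxE subr0 (le_trans (coord_le_enorm y i))// ltW.
rewrite (_ : (fun y => _) =
  (fun y => K (x - y) * \1_(pierced x r e) (x - y) * f y)); last first.
  by apply/funext => y; rewrite truncE.
have iK := integrable_pierced e0; have [mKp _] := integrableP _ _ _ iK.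
apply: (le_integrable measurableT _ _ (integrableZl measurableT C iK)).
  apply/measurable_EFinP; apply: measurable_funM; first exact/measurable_EFinP.
  exact: continuous_measurable_rV (smooth_continuous sf).
move=> y _; set A := K (x - y) * \1_(pierced x r e) (x - y).
have : `|A * f y| <= `|C * A| by rewrite normrM [leRHS]normrM (ger0_norm C0) mulrC ler_wpM2r.
by rewrite -lee_fin -!abse_EFin EFinM.
Qed.

Let g y := f y - T y.

Let sg : smooth g.
Proof.
have m0 : (mdeg (fun _ : 'I_n => 0) <= k - 2)%N by rewrite /mdeg big1.
exact: (taylor_contact x sf m0).1.
Qed.

(** The homogeneity [2 - n - k] of the kernel and the order [k - 1] of the
    Taylor remainder add up to [1 - n]. *)
Lemma kernel_remainder_bound : exists2 C, 0 <= C & forall y, eball 0 r y ->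
  `|Y (x - y) * g y| <= C * (enorm (x - y) ^+ n.-1)^-1.
Proof.
have A0 : 0 <= enorm x + r by rewrite addr_ge0 ?enorm_ge0// ltW.
have [C C0 hC] := taylor_bound (k - 2) x sf A0.
have [B B0 hB] := homog_bound hQ.
exists (B * C); first exact: mulr_ge0.
move=> y; rewrite ball0E => yr.
have xyA : enorm (x - y) <= enorm x + r.
  by rewrite (le_trans (enorm_triangle _ _))// lerD2l ltW.
have := hC y; rewrite -[enorm (y - x)]enormN opprB => /(_ xyA).
rewrite -/T -/(g y) => gy.
have [xy|xy] := eqVneq (x - y) 0.
  have -> : g y = 0.
    apply/eqP; rewrite -normr_le0; apply: le_trans gy _.
    by rewrite xy enorm0 expr0n mulr0.
  by rewrite mulr0 normr0 mulr_ge0 ?mulr_ge0// invr_ge0 exprn_ge0// enorm_ge0.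
rewrite YQ// normrM normrM normfV [`|enorm _ ^+ M|]ger0_norm ?exprn_ge0 ?enorm_ge0//.
have rho0 : 0 < enorm (x - y) by rewrite enorm_gt0.
have := hB (x - y); move: (enorm (x - y)) rho0 gy => rho rho0 gy Qy.
have rhoM : rho ^+ M = rho ^+ k * rho ^+ (k - 2).+1 * rho ^+ n.-1.
  by rewrite -!exprD (kernel_exponent n2 k2).
have nz m : rho ^+ m != 0 by rewrite expf_neq0// gt_eqF.
apply: (@le_trans _ _ (B * rho ^+ k / rho ^+ M * (C * rho ^+ (k - 2).+1))).
  apply: ler_pM => //; first by rewrite mulr_ge0// invr_ge0 exprn_ge0// ltW.
  by rewrite ler_wpM2r// invr_ge0 exprn_ge0// ltW.
rewrite rhoM le_eqVlt; apply/orP; left; apply/eqP.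
move: (nz k) (nz (k - 2).+1) (nz n.-1).
move: (rho ^+ k) (rho ^+ _) (rho ^+ n.-1) => a b c a0 b0 c0.
by field; rewrite a0 b0 c0.
Qed.

(* at y = x, where nothing is known about Y, the factor g vanishes *)
Let KgE y : Y (x - y) * g y = K (x - y) * g y.
Proof.
have [xy|xy] := eqVneq (x - y) 0; last by rewrite YQ.
have yx : y = x by apply/eqP; rewrite eq_sym -subr_eq0 xy.
have [C C0 hC] := taylor_bound (k - 2) x sf (lexx 0).
have := hC x; rewrite subrr enorm0 expr0n mulr0 => /(_ (lexx _)); rewrite normr_le0 => /eqP h.
by rewrite yx /g /T h !mulr0.
Qed.

Let mKg : measurable_fun setT (fun y => Y (x - y) * g y).
Proof.
rewrite (_ : (fun y => _) = (fun y => K (x - y) * g y)); last exact/funext.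
apply: measurable_funM => //.
exact: continuous_measurable_rV (smooth_continuous sg).
Qed.

Let ws e y : weak_singularity e (x - y) = (enorm (x - y) ^+ n.-1)^-1 * \1_(eball x e) y :> R.
Proof.
rewrite /weak_singularity !indicE; congr (_ * (nat_of_bool _)%:R).
apply/idP/idP; rewrite !inE /eball/=; by rewrite -[enorm (y - x)]enormN opprB.
Qed.

Let n1 : (1 < n)%N. Proof. by move: n2; lia. Qed.

Let ws_int A e : lam.-integrable setT (EFin \o weak_singularity e) ->
  \int[lam]_z weak_singularity e z = A ->
  lam.-integrable setT (EFin \o (fun y : 'rV[R]_n => weak_singularity e (x - y))) /\
  \int[lam]_y weak_singularity e (x - y) = A.
Proof.
move=> iw <-; split; last exact: (Rintegral_opp x iw).
have n1' : (-1 : R) != 0 by rewrite oppr_eq0 oner_eq0.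
have := integrable_affine x n1' iw.
by apply: eq_integrable => // y _ /=; rewrite scaleN1r addrC.
Qed.

Lemma integrable_remainder :
  lam.-integrable (eball 0 r) (fun y => (Y (x - y) * g y)%:E).
Proof.
apply/(integrable_indicE lam (fun y => Y (x - y) * g y) (mball 0 r)).
have [C C0 hC] := kernel_remainder_bound.
pose E := enorm x + r + 1.
have E0 : 0 < E by rewrite ltr_wpDl// addr_ge0 ?enorm_ge0// ltW.
have [A hA] := @integral_weak_singularity R n n1.
have [iw ew] := hA E E0; have [iw' _] := ws_int iw ew.
apply: (le_integrable measurableT _ _ (integrableZl measurableT C iw')).
  by apply/measurable_EFinP; apply: measurable_funM => //; apply: measurable_indic.
move=> y _; rewrite -EFinM lee_fin [leRHS]ger0_norm; last first.
  by rewrite mulr_ge0// weak_singularity_ge0.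
rewrite normrM indicE; case: (boolP (y \in _)) => [|_]; last first.
  by rewrite normr0 mulr0 mulr_ge0// weak_singularity_ge0.
rewrite inE => yr; rewrite normr1 mulr1 ws (le_trans (hC y yr))// indicE mem_set ?mulr1//.
move: yr; rewrite ball0E /eball/= -[enorm (y - x)]enormN opprB => yr.
apply: le_lt_trans (enorm_triangle _ _) _; rewrite /E -addrA ltrD2l.
by rewrite (lt_trans yr)// ltrDl.
Qed.

(* if x is outside the ball, f vanishes near x *)
Hypothesis T0 : r <= enorm x -> forall y, T y = 0.

(** In the variable [z = x - y] the Taylor polynomial is a combination of
    homogeneous polynomials [mpow (- z)] of degree at most [k - 2], each of
    which is annihilated. *)
Lemma taylor_annihilated e : 0 < e -> (enorm x < r -> e < r - enorm x) ->
  lam.-integrable setT (EFin \o (fun y => K (x - y) * \1_(pierced x r e) (x - y) * T y)) /\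
  \int[lam]_y (K (x - y) * \1_(pierced x r e) (x - y) * T y) = 0.
Proof.
move=> e0 er; have [xr|xr] := ltP (enorm x) r; last first.
  have -> : (fun y => K (x - y) * \1_(pierced x r e) (x - y) * T y) = fun=> 0.
    by apply/funext => y; rewrite T0// mulr0.
  by split; [exact: integrable0|rewrite /Rintegral integral0].
pose P (a : {ffun 'I_n -> 'I_(k - 2).+1}) := (mdeg (val \o a) <= k - 2)%N.
pose c (a : {ffun 'I_n -> 'I_(k - 2).+1}) : R :=
  mpartial (val \o a) f x / (mfact (val \o a))%:R.
pose p (a : {ffun 'I_n -> 'I_(k - 2).+1}) (z : 'rV[R]_n) : R := mpow (- z) (val \o a).
have hp (a : {ffun 'I_n -> 'I_(k - 2).+1}) : homog (mdeg (val \o a)) (p a).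
  rewrite (_ : p a = (fun z => (-1) ^+ mdeg (val \o a) * mpow z (val \o a))).
    by apply: homogZ; exact: homog_mpow.
  by apply/funext => z; rewrite /p (homogN _ (homog_mpow _)).
pose F (a : {ffun 'I_n -> 'I_(k - 2).+1}) (z : 'rV[R]_n) : R :=
  if P a then c a * (Q z * p a z / enorm z ^+ M * \1_(pierced x r e) z) else 0.
have iF (a : {ffun 'I_n -> 'I_(k - 2).+1}) :
    lam.-integrable setT (EFin \o F a) /\ \int[lam]_z F a z = 0.
  rewrite /F; case: (boolP (P a)) => Pa; last first.
    by split; [exact: integrable0|rewrite /Rintegral integral0].
  have mk : (mdeg (val \o a) + 2 <= k)%N by move: Pa; rewrite /P; move: k2; lia.
  have i1 := kernel_integrable hQ (hp a) x r e0.
  split; first exact: (integrableZl measurableT (c a) i1).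
  by rewrite RintegralZl// (annihilation n2 mk hQ lQ (hp a) xr e0 (er xr)) mulr0.
have [iS eS] := @Rintegral_sum R n _ (index_enum _) F (fun a => (iF a).1).
pose G z := \sum_(a <- index_enum _) F a z.
have GE : (fun y => K (x - y) * \1_(pierced x r e) (x - y) * T y) = (fun y => G (x - y)).
  apply/funext => y; rewrite /G /F -big_mkcond /= /T /taylor mulr_sumr.
  apply: eq_bigr => a _; rewrite /p opprB /K -/(c a).
  move: (c a) (mpow _ _) (Q _) (enorm _ ^+ _) (\1_(_) _) => u v w s t.
  by rewrite mulrA; ring.
have n1' : (-1 : R) != 0 by rewrite oppr_eq0 oner_eq0.
rewrite GE; split.
  have := integrable_affine x n1' iS.
  by apply: eq_integrable => // y _ /=; rewrite scaleN1r addrC.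
rewrite (Rintegral_opp x iS) /G eS big1// => a _; exact: (iF a).2.
Qed.

(** The integrand on the left vanishes off the ball of radius [r], and on the
    pierced ball the Taylor polynomial may be subtracted from [f]. *)
Lemma truncated_remainder e : 0 < e -> (enorm x < r -> e < r - enorm x) ->
  \int[lam]_(y in ~` eball x e) (Y (x - y) * f y) =
  \int[lam]_(y in eball 0 r) (Y (x - y) * g y * \1_(~` eball x e) y).
Proof.
move=> e0 er; rewrite [LHS]Rintegral_indicE [RHS]Rintegral_indicE.
have [iT eT] := taylor_annihilated e0 er.
have if_ := (integrable_indicE lam _ (measurableC (mball x e))).1 (integrable_truncated e0).
have E1 : (fun y => Y (x - y) * f y * \1_(~` eball x e) y) =
    (fun y => K (x - y) * \1_(pierced x r e) (x - y) * f y).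
  by apply/funext => y; rewrite truncE.
rewrite E1 in if_; rewrite E1.
transitivity (\int[lam]_y (K (x - y) * \1_(pierced x r e) (x - y) * f y -
   K (x - y) * \1_(pierced x r e) (x - y) * T y)).
  by rewrite RintegralB// eT subr0.
apply: eq_Rintegral => y _; rewrite KgE pierced_sub /g.
by move: (K _) (\1_(_) y) (\1_(~` _) y) (f y) (T y) => a b c d s; ring.
Qed.

(** The difference is the integral of the kernel against the Taylor remainder
    over the ball of radius [e] about [x], where [weak_singularity] dominates. *)
Lemma truncated_error : exists B, forall e, 0 < e -> (enorm x < r -> e < r - enorm x) ->
  `|\int[lam]_(y in eball 0 r) (Y (x - y) * g y) -
    \int[lam]_(y in ~` eball x e) (Y (x - y) * f y)| <= B * e.
Proof.
have [C C0 hC] := kernel_remainder_bound.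
have [A hA] := @integral_weak_singularity R n n1.
exists (C * A) => e e0 er; rewrite truncated_remainder//.
have [iw ew] := hA e e0; have [iw' ew'] := ws_int iw ew.
rewrite (Rintegral_indicE _ (eball 0 r)) [X in _ - X](Rintegral_indicE _ (eball 0 r)).
have iR := (integrable_indicE lam _ (mball 0 r)).1 integrable_remainder.
have mD : measurable (~` eball x e) by exact: measurableC (mball x e).
have dom (E : set 'rV[R]_n) : measurable E -> lam.-integrable setT
    (EFin \o (fun y => Y (x - y) * g y * \1_E y * \1_(eball 0 r) y)).
  move=> mE; apply: (le_integrable measurableT _ _ iR).
    apply/measurable_EFinP; apply: measurable_funM; last exact: measurable_indic.
    by apply: measurable_funM => //; exact: measurable_indic.
  move=> y _; rewrite lee_fin !normrM ler_wpM2r// ler_piMr//.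
  by rewrite indicE normr_nat lern1 leq_b1.
rewrite -RintegralB//; last exact: dom.
have iE := dom _ (mball x e).
have EE : (fun y => Y (x - y) * g y * \1_(eball 0 r) y -
      Y (x - y) * g y * \1_(~` eball x e) y * \1_(eball 0 r) y) =
    (fun y => Y (x - y) * g y * \1_(eball x e) y * \1_(eball 0 r) y).
  apply/funext => y; rewrite [\1_(~` _) y]indicE in_setC [\1_(eball x e) y]indicE.
  by case: (y \in eball x e); rewrite /= ?mulr0 ?mul0r ?mulr1 ?subr0 ?subrr.
rewrite EE.
apply: le_trans (le_normr_Rintegral measurableT iE) _.
have -> : C * A * e = \int[lam]_y (C * weak_singularity e (x - y)).
  by rewrite RintegralZl// ew'; ring.
apply: le_Rintegral => //.
- exact: (integrable_norm iE).
- exact: (integrableZl measurableT C iw').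
move=> y _; rewrite ws !normrM.
case: (boolP (y \in eball 0 r)) => yr; last first.
  rewrite [\1_(eball 0 r) y]indicE (negbTE yr) normr0 mulr0 mulr_ge0//.
  by rewrite mulr_ge0 ?invr_ge0 ?exprn_ge0 ?enorm_ge0.
rewrite [\1_(eball 0 r) y]indicE yr normr1 mulr1 -normrM.
rewrite [`|\1_(eball x e) y|]ger0_norm// mulrA ler_wpM2r//.
by apply: hC; rewrite -inE.
Qed.

Lemma truncated_cvg :
  \int[lam]_(y in ~` eball x e) (Y (x - y) * f y) @[e --> 0^'+] -->
  \int[lam]_(y in eball 0 r) (Y (x - y) * g y).
Proof.
have [B hB] := truncated_error.
apply/cvgrPdist_le => eps eps0.
pose s := if enorm x < r then r - enorm x else 1.
have s0 : 0 < s by rewrite /s; case: ifP => // ?; rewrite subr_gt0.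
near=> e.
have e0 : 0 < e by near: e; exact: nbhs_right_gt.
apply: le_trans (hB e e0 _) _.
  move=> xr; have -> : r - enorm x = s by rewrite /s xr.
  by near: e; exact: nbhs_right_lt.
apply: (@le_trans _ _ ((`|B| + 1) * e)).
  by rewrite ler_wpM2r ?(ltW e0)// (le_trans (ler_norm _))// lerDl.
have B1 : 0 < `|B| + 1 by rewrite ltr_wpDl.
rewrite mulrC -ler_pdivlMr//; near: e; apply: nbhs_right_le.
by rewrite divr_gt0.
Unshelve. all: by end_near. Qed.

End principal_value.

(** * Compactly supported functions and the theorem *)

Section support.
Context {R : realType} {n : nat}.
Implicit Types (f : 'rV[R]_n -> R) (x y : 'rV[R]_n) (r : R).

Lemma supp_eq0 f y : ~ supp f y -> f y = 0.
Proof.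
move=> h; apply/eqP; apply: contrapT => /negP fy; apply: h.
exact: subset_closure.
Qed.

Lemma supp_sub_eq0 f r y : supp f `<=` eball 0 r -> r <= enorm y -> f y = 0.
Proof.
move=> fr yr; apply: supp_eq0 => /fr; rewrite /eball/= subr0.
by rewrite ltNge yr.
Qed.

(** [x] lies in the complement of the support, an open set on which [f]
    vanishes. *)
Lemma taylor_outside_supp f r x j : supp f `<=` eball 0 r -> r <= enorm x ->
  forall y, taylor j x f y = 0.
Proof.
move=> fr xr y; apply: (@taylor_open0 _ _ j (~` supp f)).
- by rewrite openC; exact: closed_closure.
- by move=> z; exact: supp_eq0.
- by move=> /fr; rewrite /eball/= subr0 ltNge xr.
Qed.

Lemma compact_supp_sub f : compact (supp f) ->
  exists2 r, 0 < r & supp f `<=` eball 0 r.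
Proof.
move=> cf.
have [E|/set0P[y0 fy0]] := eqVneq (supp f) set0.
  by exists 1; rewrite ?ltr01// E.
have [c _ hc] : exists2 c, supp f c & forall t, supp f t -> enorm t <= enorm c.
  have [||c cs hc] := @EVT_max_rV R n enorm (supp f) _ cf.
    by exists y0.
    by apply: continuous_subspaceT; exact: enorm_continuous.
  by exists c; [rewrite -inE|move=> t ft; apply: hc; rewrite inE].
exists (enorm c + 1); first by rewrite ltr_wpDl ?enorm_ge0.
by move=> y /hc yc; rewrite /eball/= subr0 (le_lt_trans yc)// ltrDl.
Qed.

End support.

Section kernel_Gamma.
Context {R : realType} {n : nat}.
Variables (beta : 'I_n -> nat) (f : 'rV[R]_n -> R) (r : R).
Local Notation k := (mdeg beta).
Hypotheses (n3 : (3 <= n)%N) (k2 : (2 <= k)%N).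
Hypotheses (sf : smooth f) (r0 : 0 < r) (fr : supp f `<=` eball 0 r).

Lemma pv_Gamma x :
  [/\ forall e, 0 < e -> (lebesgue_rV n).-integrable (~` eball x e)
        (fun y => (mpartial beta Gamma (x - y) * f y)%:E),
      (lebesgue_rV n).-integrable (eball 0 r)
        (fun y => (mpartial beta Gamma (x - y)
                   * (f y - taylor (k - 2) x f y))%:E) &
      truncated beta f x e @[e --> 0^'+] -->
        \int[lebesgue_rV n]_(y in eball 0 r)
          (mpartial beta Gamma (x - y) * (f y - taylor (k - 2) x f y))].
Proof.
have [Q [hQ lQ YQ]] := @kelvin_mpartial_Gamma R n (ltnW n3) beta.
have f0 y : r <= enorm y -> f y = 0 by exact: supp_sub_eq0.
have T0 : r <= enorm x -> forall y, taylor (k - 2) x f y = 0.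
  by move=> xr; exact: taylor_outside_supp fr xr.
split.
- by move=> e e0; exact: (integrable_truncated k2 hQ YQ sf r0 f0 x e0).
- exact: (integrable_remainder n3 k2 hQ YQ sf r0).
- exact: (truncated_cvg n3 k2 hQ lQ YQ sf r0 f0 T0).
Qed.

Lemma pvE x : pv beta f x = \int[lebesgue_rV n]_(y in eball 0 r)
  (mpartial beta Gamma (x - y) * (f y - taylor (k - 2) x f y)).
Proof. by have [_ _] := pv_Gamma x; exact: cvg_lim. Qed.

End kernel_Gamma.

Theorem theorem4p2 (R : realType) (n : nat) (hn : (3 <= n)%N)
    (k : nat) (hk : (2 <= k)%N) (beta : 'I_n -> nat) (hbeta : mdeg beta = k)
    (f : 'rV[R]_n -> R) (hf : Cc_infty f) :
  (forall x : 'rV[R]_n, pv_exists beta f x) /\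
  (forall (r : R), 0 < r -> supp f `<=` eball 0 r ->
    forall x : 'rV[R]_n,
      (lebesgue_rV n).-integrable (eball 0 r)
        (fun y => (mpartial beta Gamma (x - y)
                   * (f y - taylor (k - 2) x f y))%:E) /\
      pv beta f x =
        \int[lebesgue_rV n]_(y in eball 0 r)
          (mpartial beta Gamma (x - y) * (f y - taylor (k - 2) x f y))) /\
  (forall (r r' : R), 0 < r -> 0 < r' ->
    supp f `<=` eball 0 r -> supp f `<=` eball 0 r' ->
    forall x : 'rV[R]_n,
      \int[lebesgue_rV n]_(y in eball 0 r)
        (mpartial beta Gamma (x - y) * (f y - taylor (k - 2) x f y)) =
      \int[lebesgue_rV n]_(y in eball 0 r')
        (mpartial beta Gamma (x - y) * (f y - taylor (k - 2) x f y))).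
Proof.
case: hf => sf cf; subst k; split; [|split].
- move=> x; have [r r0 fr] := compact_supp_sub cf.
  have [iT _ cT] := pv_Gamma hn hk sf r0 fr x.
  by split=> //; exact: cvgP cT.
- move=> r r0 fr x; split; last exact: pvE.
  by have [_ iR _] := pv_Gamma hn hk sf r0 fr x.
- by move=> r r' r0 r'0 fr fr' x; rewrite -!pvE.
Qed.
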